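(* Let $K$ be a field of characteristic $0$ and let $k\geq 3$ be an integer. There is a polynomial $p_k(n)$ in $n$ with rational coefficients, of degree $2k-2$, such that for all $n\geq 2k$, $$\gamma_n(\mathfrak{N}_{2k+1})\geq\gamma_n(\mathfrak{N}_{2k})\geq p_k(n),$$ where, when $k\geq 4$, the leading coefficient of $p_k(n)$ is equal to $$\frac{2^{2k-3}+C_k}{(2k-2)!},$$ and, when $k=3$, the leading coefficient of $p_k(n)$ is equal to $$\frac{2^{2k-3}+C_{k-1}}{(2k-2)!}.$$ For $n\leq 2k$, it holds that $\Gamma_n(\mathfrak{N}_{2k+1})=\Gamma_n(\mathfrak{N}_{2k})=\Gamma_n$. Furthermore, for $2k+1\leq n\leq 4k$, $\gamma_n(\mathfrak{N}_{2k+1})$ is strictly bigger than $\gamma_n(\mathfrak{N}_{2k})$.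
   Context: $C_k=\frac{1}{k+1}\binom{2k}{k}$ is the $k$-th Catalan number. $K\langle X\rangle$ is the free unital associative $K$-algebra on $X=\{x_1,x_2,\dots\}$ and $K\langle X_n\rangle$ the free unital subalgebra generated by $x_1,\dots,x_n$. Commutators are left-normed: $[u_1,u_2]=u_1u_2-u_2u_1$, $[u_1,\dots,u_{m+1}]=[[u_1,\dots,u_m],u_{m+1}]$. $I_{p+1}$ is the two-sided ideal of $K\langle X\rangle$ generated by all commutators $[u_1,\dots,u_{p+1}]$, $u_i\in K\langle X\rangle$. $\mathfrak{N}_p$ is the variety of unital associative $K$-algebras satisfying $[x_1,\dots,x_{p+1}]=0$, and $F_n(\mathfrak{N}_p)=K\langle X_n\rangle/(I_{p+1}\cap K\langle X_n\rangle)$. $\Gamma_n\subset K\langle X_n\rangle$ is the space of multilinear polynomials of degree $n$ in $x_1,\dots,x_n$ that are proper, i.e. linear combinations of products of commutators (of length at least $2$) whose entries are variables. $\Gamma_n(\mathfrak{N}_p)$ is the image of $\Gamma_n$ in $F_n(\mathfrak{N}_p)$, and $\gamma_n(\mathfrak{N}_p)=\dim\Gamma_n(\mathfrak{N}_p)$. The equality $\Gamma_n(\mathfrak{N}_p)=\Gamma_n$ means that the natural surjection $\Gamma_n\to\Gamma_n(\mathfrak{N}_p)$ is an isomorphism. *)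

(* Defs.v *)
From HB Require Import structures.
From mathcomp Require Import all_boot all_order all_algebra.
From mathcomp Require Import generic_quotient ring_quotient.
From mathcomp Require Import boolp classical_sets functions.
From mathcomp Require Import monalg.

Set Implicit Arguments.
Unset Strict Implicit.
Unset Printing Implicit Defensive.

Import GRing.Theory.
Local Open Scope ring_scope.
Local Open Scope classical_set_scope.
Local Open Scope quotient_scope.

Section LinearAlgebra.
Variables (K : fieldType) (V : lmodType K).

Definition is_submod (W : set V) : Prop :=
  W 0 /\ forall a u v, W u -> W v -> W (a *: u + v).

Definition lin_span (S : set V) : set V := smallest is_submod S.

Definition lin_indep (d : nat) (b : 'I_d -> V) : Prop :=
  forall c : 'I_d -> K, \sum_i c i *: b i = 0 -> forall i, c i = 0.

Definition is_basis (W : set V) (d : nat) (b : 'I_d -> V) : Prop :=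
  [/\ forall i, W (b i), lin_indep b &
      forall w, W w -> exists c : 'I_d -> K, w = \sum_i c i *: b i].

(* The value is 0 when W has no finite basis; see [dimE] and
   [GammaN_has_basis] below. *)
Definition dim (W : set V) : nat :=
  xget 0%N [set d | exists b : 'I_d -> V, is_basis W b].

(* Steinitz: an independent family in the span of N vectors has at most N
   elements. *)
Lemma lin_indep_le (N d : nat) (e : 'I_N -> V) (b : 'I_d -> V) :
  lin_indep b ->
  (forall i, exists c : 'I_N -> K, b i = \sum_j c j *: e j) -> (d <= N)%N.
Proof.
move=> ib /(_ _)/cid-/all_sig[c cE].
pose M := \matrix_(i < d, j < N) c i j.
suff : row_free M by rewrite /row_free => /eqP <-; exact: rank_leq_col.
rewrite -kermx_eq0; apply/rowV0P => u /sub_kermxP uM.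
apply/rowP => i; rewrite mxE; apply: (ib (fun i => u 0 i)).
under eq_bigr do rewrite cE scaler_sumr.
rewrite exchange_big big1 //= => j _.
under eq_bigr do rewrite scalerA.
rewrite -scaler_suml (_ : \sum_(_ < _) _ = 0) ?scale0r //.
transitivity ((u *m M) 0 j); last by rewrite uM mxE.
by rewrite mxE; apply: eq_bigr => l _; rewrite mxE.
Qed.

Lemma dimE (W : set V) (d : nat) (b : 'I_d -> V) : is_basis W b -> dim W = d.
Proof.
move=> bW; rewrite /dim; case: xgetP => [d' _ [b' b'W]|/(_ d)[]]; last by exists b.
case: bW b'W => bW ib sb [b'W ib' sb'].
apply/eqP; rewrite eqn_leq; apply/andP; split.
  by apply: lin_indep_le ib' _ => i; apply: sb.
by apply: lin_indep_le ib _ => i; apply: sb'.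
Qed.

Lemma has_basis (W : set V) (N : nat) (e : 'I_N -> V) : is_submod W ->
  (forall w, W w -> exists c : 'I_N -> K, w = \sum_i c i *: e i) ->
  exists (d : nat) (b : 'I_d -> V), is_basis W b.
Proof.
move=> [W0 Wlin] We.
pose P d := `[< exists b : 'I_d -> V, (forall i, W (b i)) /\ lin_indep b >].
have exP : exists d, P d.
  exists 0%N; apply/asboolP; exists (fun=> 0); split=> [[]//|c _ []//].
have leP d : P d -> (d <= N)%N.
  by move=> /asboolP[b [bW ib]]; apply: lin_indep_le ib _ => i; apply: We.
case: (ex_maxnP exP leP) => d /asboolP[b [bW ib]] dmax.
exists d, b; split=> // w Ww; apply: contrapT => nw.
suff /dmax : P d.+1 by rewrite ltnn.
apply/asboolP; exists (fun i => oapp b w (unlift ord0 i)); split.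
  by move=> i; case: unlift.
move=> c; rewrite big_ord_recl unlift_none /=.
under eq_bigr do rewrite liftK /=.
have [c0 | c0] := eqVneq (c ord0) 0.
  rewrite c0 scale0r add0r => /ib cl i.
  by case: (unliftP ord0 i) => [j ->|->].
move=> /eqP; rewrite addr_eq0 => /eqP cw.
case: nw; exists (fun i => - (c ord0)^-1 * c (lift ord0 i)).
under eq_bigr do rewrite -scalerA.
by rewrite -scaler_sumr scaleNr -scalerN -cw scalerA mulVf // scale1r.
Qed.

End LinearAlgebra.

Section Ideals.
Variable A : pzRingType.

Definition is_ideal (J : set A) : Prop :=
  [/\ J 0, forall u v, J u -> J v -> J (u - v),
      forall a u, J u -> J (a * u) & forall a u, J u -> J (u * a)].

Definition ideal_gen (S : set A) : set A := smallest is_ideal S.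

Lemma ideal_gen_is_ideal (S : set A) : is_ideal (ideal_gen S).
Proof.
split.
- by move=> J [[J0 _ _ _] _].
- move=> u v Su Sv J JS; have [[_ JB _ _] _] := JS.
  by apply: JB; [exact: Su|exact: Sv].
- by move=> a u Su J JS; have [[_ _ Jl _] _] := JS; exact/Jl/(Su _ JS).
- by move=> a u Su J JS; have [[_ _ _ Jr] _] := JS; exact/Jr/(Su _ JS).
Qed.

Definition comm (u v : A) : A := u * v - v * u.

(* [lcomm u [:: v1; ...; vm]] is the left-normed [u, v1, ..., vm], of length
   m + 1. *)
Definition lcomm (u : A) (s : seq A) : A := foldl comm u s.

Definition commutators (m : nat) : set A :=
  [set f | exists (u : A) (s : seq A), (size s).+1 = m /\ f = lcomm u s].

Definition comm_ideal (m : nat) : set A := ideal_gen (commutators m).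

End Ideals.

Section FreeAlgebra.
Variable K : fieldType.

Definition freealg := {malg K[{fmonom nat}]}.
HB.instance Definition _ := GRing.Lalgebra.on freealg.

(* Indices are shifted: [xvar i] is the variable x_{i+1}, so that
   x_1, ..., x_n are the [xvar i] with i < n. *)
Definition xvar (i : nat) : freealg := << fmu i >>.

Definition is_subalg (B : set freealg) : Prop :=
  [/\ B 1, forall a u v, B u -> B v -> B (a *: u + v) &
      forall u v, B u -> B v -> B (u * v)].

Definition subalg_gen (S : set freealg) : set freealg := smallest is_subalg S.

Definition in_freealgn (n : nat) : {pred freealg} :=
  fun f => `[< subalg_gen [set f | exists2 i : nat, (i < n)%N & f = xvar i] f >].

Fact in_freealgn_subalg (n : nat) : subalg_closed (in_freealgn n).
Proof.
split.
- by apply/asboolP => B [[]].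
- move=> a u v /asboolP Bu /asboolP Bv; apply/asboolP => B BS.
  have [[_ Bl _] _] := BS; by apply: Bl; [exact: Bu|exact: Bv].
- move=> u v /asboolP Bu /asboolP Bv; apply/asboolP => B BS.
  have [[_ _ BM] _] := BS; by apply: BM; [exact: Bu|exact: Bv].
Qed.

HB.instance Definition _ (n : nat) :=
  GRing.isSubalgClosed.Build K freealg (in_freealgn n) (in_freealgn_subalg n).

Record freealgn (n : nat) : Type :=
  FreeAlgn { freealgn_val : freealg; _ : in_freealgn n freealgn_val }.

HB.instance Definition _ (n : nat) := [isSub for @freealgn_val n].
HB.instance Definition _ (n : nat) := [Choice of freealgn n by <:].
HB.instance Definition _ (n : nat) :=
  [SubChoice_isSubLalgebra of freealgn n by <:].

(* I_{p+1} \cap K<X_n>: note the shift between the class p of the variety N_p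
   and the length p + 1 of the commutators. *)
Definition freealgn_ideal (p n : nat) : {pred freealgn n} :=
  fun f => `[< comm_ideal p.+1 (\val f) >].

Arguments freealgn_ideal : clear implicits.

Fact freealgn_ideal_zmod (p n : nat) : zmod_closed (freealgn_ideal p n).
Proof.
have [I0 IB _ _] := ideal_gen_is_ideal (@commutators freealg p.+1).
split=> [|u v /asboolP Iu /asboolP Iv]; apply/asboolP.
  by rewrite raddf0.
by rewrite raddfB; apply: IB.
Qed.

HB.instance Definition _ (p n : nat) :=
  GRing.isZmodClosed.Build (freealgn n) (freealgn_ideal p n)
    (freealgn_ideal_zmod p n).

Fact freealgn_idealM (p n : nat) (a u : freealgn n) :
  u \in freealgn_ideal p n ->
  (a * u \in freealgn_ideal p n) * (u * a \in freealgn_ideal p n).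
Proof.
have [_ _ Il Ir] := ideal_gen_is_ideal (@commutators freealg p.+1).
by move=> /asboolP Iu; split; apply/asboolP; rewrite rmorphM; [apply: Il|apply: Ir].
Qed.

(* F_n(N_p) = K<X_n> / (I_{p+1} \cap K<X_n>). *)
Definition relfree (p n : nat) : Type := Quotient.quot (freealgn_ideal p n).
HB.instance Definition _ (p n : nat) := GRing.Zmodule.on (relfree p n).
HB.instance Definition _ (p n : nat) := EqQuotient.on (relfree p n).

Definition relfree_pi (p n : nat) : freealgn n -> relfree p n := \pi.

Section RelfreeAlgebra.
Variables p n : nat.
Local Notation Q := (relfree p n).
Local Notation pi := (@relfree_pi p n).

Lemma relfree_eqE (f g : freealgn n) :
  (pi f = pi g) <-> comm_ideal p.+1 (\val f - \val g).
Proof.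
rewrite -raddfB; split.
  by move=> /eqP; rewrite -Quotient.idealrBE => /asboolP.
by move=> fg; apply/eqP; rewrite -Quotient.idealrBE; apply/asboolP.
Qed.

Fact relfree_pi_zmod : zmod_morphism pi.
Proof. by move=> f g; rewrite /relfree_pi raddfB. Qed.

Let piK (x : Q) : pi (repr x) = x. Proof. exact: reprK. Qed.

Let piP (f g : freealgn n) : f - g \in freealgn_ideal p n -> pi f = pi g.
Proof. by move=> fg; apply/eqP; rewrite -Quotient.idealrBE. Qed.

Let pi_mem (f g : freealgn n) : pi f = pi g -> f - g \in freealgn_ideal p n.
Proof. by move=> /eqP; rewrite -Quotient.idealrBE. Qed.

Definition relfree_scale (a : K) (x : Q) : Q := pi (a *: repr x).
Definition relfree_one : Q := pi 1.
Definition relfree_mul (x y : Q) : Q := pi (repr x * repr y).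

Lemma relfree_piZ (a : K) (f : freealgn n) :
  pi (a *: f) = relfree_scale a (pi f).
Proof.
apply: piP; rewrite -scalerBr -mulr_algl.
by apply: (freealgn_idealM _ (pi_mem _)).1; rewrite piK.
Qed.

Lemma relfree_piM (f g : freealgn n) :
  pi (f * g) = relfree_mul (pi f) (pi g).
Proof.
apply: piP; set f' := repr _; set g' := repr _.
rewrite -(subrKA (f' * g)) -mulrBl -mulrBr; apply: rpredD.
  by apply: (freealgn_idealM _ (pi_mem _)).2; rewrite piK.
by apply: (freealgn_idealM _ (pi_mem _)).1; rewrite piK.
Qed.

Let piD (f g : freealgn n) : pi (f + g) = pi f + pi g.
Proof. by rewrite /relfree_pi raddfD. Qed.

Fact relfree_scalerA a b (x : Q) :
  relfree_scale a (relfree_scale b x) = relfree_scale (a * b) x.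
Proof. by rewrite -[x]piK -!relfree_piZ scalerA. Qed.
Fact relfree_scale1r : left_id 1 relfree_scale.
Proof. by move=> x; rewrite -[x]piK -relfree_piZ scale1r. Qed.
Fact relfree_scalerDr : right_distributive relfree_scale +%R.
Proof.
by move=> a x y; rewrite -[x]piK -[y]piK -piD -!relfree_piZ -piD scalerDr.
Qed.
Fact relfree_scalerDl (x : Q) : {morph relfree_scale^~ x : a b / a + b}.
Proof. by move=> a b; rewrite -[x]piK -!relfree_piZ -piD scalerDl. Qed.

HB.instance Definition _ := GRing.Zmodule_isLmodule.Build K (relfree p n)
  relfree_scalerA relfree_scale1r relfree_scalerDr relfree_scalerDl.

Fact relfree_mulA : associative relfree_mul.
Proof.
by move=> x y z; rewrite -[x]piK -[y]piK -[z]piK -!relfree_piM mulrA.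
Qed.
Fact relfree_mul1r : left_id relfree_one relfree_mul.
Proof. by move=> x; rewrite -[x]piK -relfree_piM mul1r. Qed.
Fact relfree_mulr1 : right_id relfree_one relfree_mul.
Proof. by move=> x; rewrite -[x]piK -relfree_piM mulr1. Qed.
Fact relfree_mulDl : left_distributive relfree_mul +%R.
Proof.
move=> x y z; rewrite -[x]piK -[y]piK -[z]piK.
by rewrite -piD -!relfree_piM -piD mulrDl.
Qed.
Fact relfree_mulDr : right_distributive relfree_mul +%R.
Proof.
move=> x y z; rewrite -[x]piK -[y]piK -[z]piK.
by rewrite -piD -!relfree_piM -piD mulrDr.
Qed.

HB.instance Definition _ := GRing.Zmodule_isPzRing.Build (relfree p n)
  relfree_mulA relfree_mul1r relfree_mulr1 relfree_mulDl relfree_mulDr.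

HB.instance Definition _ := GRing.isZmodMorphism.Build
  (freealgn n) (relfree p n) pi relfree_pi_zmod.
HB.instance Definition _ := GRing.isScalable.Build
  K (freealgn n) (relfree p n) *:%R pi relfree_piZ.
HB.instance Definition _ := GRing.isMonoidMorphism.Build
  (freealgn n) (relfree p n) pi (erefl, relfree_piM).

End RelfreeAlgebra.

Definition multilinear (n : nat) (f : freealg) : Prop :=
  forall m : {fmonom nat}, f@_m != 0 -> perm_eq m (iota 0 n).

(* The empty product 1 is allowed; it is only relevant to degree 0. *)
Definition comm_products : set freealg :=
  [set f | exists2 cs : seq (nat * seq nat),
     all (fun c => 0 < size c.2)%N cs &
     f = \prod_(c <- cs) lcomm (xvar c.1) (map xvar c.2)].

Definition proper_poly : set freealg := lin_span comm_products.

Definition Gamma (n : nat) : set (freealgn n) :=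
  [set f | multilinear n (\val f) /\ proper_poly (\val f)].
Arguments Gamma : clear implicits.

Definition GammaN (p n : nat) : set (relfree p n) :=
  @relfree_pi p n @` Gamma n.
Arguments GammaN : clear implicits.

Definition gammaN (p n : nat) : nat := dim (GammaN p n).

Lemma xmonom_in_freealgn (n : nat) (s : seq nat) :
  all (ltn^~ n) s -> (<< FMonom s >> : freealg) \in in_freealgn n.
Proof.
elim: s => [_|i s IHs /= /andP[ltin /IHs sn]].
  rewrite (_ : << _ >> = 1) ?rpred1 //.
  by congr (<< _ >>); apply/esym/fmoneE.
rewrite (_ : << _ >> = xvar i * (<< FMonom s >> : freealg)).
  rewrite rpredM //; apply/asboolP => B [_]; apply.
  by exists i.
rewrite /xvar malgM_def fgmulUU mul1r; congr (<< _ >>).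
by apply: val_inj; rewrite /= fmM fmU.
Qed.

Lemma GammaN_has_basis (p n : nat) :
  exists (d : nat) (b : 'I_d -> relfree p n), is_basis (GammaN p n) b.
Proof.
pose ps := permutations (iota 0 n).
have ps_in s : s \in ps -> (<< FMonom s >> : freealg) \in in_freealgn n.
  rewrite mem_permutations => sP; apply: xmonom_in_freealgn.
  by apply/allP => i; rewrite (perm_mem sP) mem_iota.
pose mon (i : 'I_(size ps)) : freealgn n :=
  FreeAlgn (ps_in _ (mem_nth [::] (ltn_ord i))).
apply: (@has_basis _ _ _ _ (fun i => relfree_pi p (mon i))).
  split.
    exists 0; last exact: raddf0.
    split; first by move=> m; rewrite !raddf0 eqxx.
    by rewrite raddf0 => W [[]].
  move=> a _ _ [f [fm fp] <-] [g [gm gp] <-]; exists (a *: f + g); last first.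
    by rewrite linearP.
  split.
    move=> m; rewrite [\val (_ + _)]linearP mcoeffD mcoeffZ => nz.
    have [f0|] := eqVneq ((\val f)@_m) 0; last exact: fm.
    by apply: gm; apply: contra_neq nz => ->; rewrite f0 mulr0 addr0.
  rewrite linearP => W WS; have [[_ Wl] _] := WS.
  by apply: Wl; [exact: fp|exact: gp].
move=> _ [f [fm _] <-].
exists (fun i => (\val f)@_(FMonom (nth [::] ps i))).
under [RHS]eq_bigr do rewrite -linearZ.
rewrite -linear_sum; congr (relfree_pi _ _); apply: val_inj.
rewrite raddf_sum; apply/malgP => m; rewrite raddf_sum /=.
under eq_bigr do rewrite mcoeffZ mcoeffU.
have [mP|mNP] := boolP (fmonom_val m \in ps).
  have ltm : (index (fmonom_val m) ps < size ps)%N by rewrite index_mem.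
  rewrite (bigD1 (Ordinal ltm)) //= nth_index // fmK eqxx mulr1 big1 ?addr0 //.
  move=> i ine; rewrite -val_eqE /=; case: eqP => [im|]; last by rewrite mulr0.
  case/eqP: ine; apply: val_inj => /=.
  by rewrite -im index_uniq // permutations_uniq.
rewrite big1 => [|i _].
  apply/eqP; apply: contraNT mNP => /fm.
  by rewrite mem_permutations.
rewrite -val_eqE /=; case: eqP => [im|]; last by rewrite mulr0.
by case/negP: mNP; rewrite -im mem_nth.
Qed.

End FreeAlgebra.

Arguments freealg : clear implicits.
Arguments freealgn : clear implicits.
Arguments relfree : clear implicits.
Arguments relfree_pi : clear implicits.
Arguments Gamma : clear implicits.
Arguments GammaN : clear implicits.
Arguments gammaN : clear implicits.

Definition catalan (k : nat) : rat := 'C(k.*2, k)%:R / k.+1%:R.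

(* Main.v *)
From HB Require Import structures.
Require Import Defs.
From mathcomp Require Import all_boot all_order all_algebra.
From mathcomp Require Import boolp classical_sets functions.
From mathcomp Require Import finmap monalg.
From mathcomp Require Import ring zify.

(* Give each letter a parity and link some disjoint pairs of letters; two letters
   anticommute when exactly one of "both are odd", "they are linked" holds.
   Reordering the letters of a multilinear word accordingly produces a sign, hence
   a linear functional.  On a left-normed commutator [u_1, ..., u_r] of words it is
   nonzero iff u_1...u_i and u_(i+1) anticommute for every i.  Such a step either
   uses up a link, or brackets two odd words into an even one; in the latter case
   the next step must use up a link.  So m links allow at most 2m + 1 steps, and
   the functional kills I_(2k+1) when m = k - 1.

   For the lower bound, every set of k - 1 disjoint ordered pairs of letters
   determines such a functional and a proper polynomial, and these are dual to each
   other.  There are about n^(2k-2) / (k-1)! such sets, which exceeds the required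
   leading term.

   For the strict inequality take k links and exactly 2k odd letters, every even
   letter being linked.  The functional then kills I_(2k+2) but not I_(2k+1).  An
   element of I_(2k+1) is made proper by the operators f - x_s (df/dx_s), and the
   functional also kills all x_s I_(2k+1), so it does not see the correction. *)

Set Implicit Arguments.
Unset Strict Implicit.
Unset Printing Implicit Defensive.

Import Order.TTheory GRing.Theory Num.Theory.
Local Open Scope ring_scope.

(** * The free algebra through its basis of words *)

(** Ordering the pairs is what makes the family large enough: unordered pairs would lose a factor
    2^(k-1) and miss the required leading coefficient for k = 3, 4, 5. The functional sees the order
    through parities: an increasing pair gets two odd letters and a decreasing pair two even ones.
    With m = k - 1, the comparison needed is (2^(2m-1) + C_(m+1)) m! <= (2m)!. For m >= 3 it follows
    from C_(m+1) <= 2^(2m-1) and 4^m m! <= (2m)!; for m = 2 it holds with C_2 in place of C_3, but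
    fails with C_3.

    For the strict inequality, the bound 2k + 1 on the number of steps with k links is too weak by
    one. A finer count also charges the odd letters, and gives at most k + (2k)/2 = 2k steps.
    Setting aside any one letter loses an odd letter or a link, so fewer than 2k steps remain. As k
    links cover 2k letters, there can be at most 2k even letters, whence n <= 4k. *)

Section Span.
Variables (K : fieldType) (V : lmodType K).

Lemma lin_span_submod (S : set V) : is_submod (lin_span S).
Proof.
split=> [W [[]]//|a u v Su Sv W WS].
by have [[_ Wl] _] := WS; apply: Wl; [exact: Su|exact: Sv].
Qed.

Lemma lin_span_sub (S : set V) x : S x -> lin_span S x.
Proof. by move=> Sx W [_]; apply. Qed.

Lemma lin_span_ind (S : set V) (P : V -> Prop) :
  P 0 -> (forall a u v, P u -> P v -> P (a *: u + v)) -> (forall x, S x -> P x) ->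
  forall x, lin_span S x -> P x.
Proof. by move=> P0 Pl PS x; apply. Qed.

Lemma submodD (W : set V) : is_submod W -> forall u v, W u -> W v -> W (u + v).
Proof. by move=> [_ Wl] u v Wu Wv; rewrite -[u]scale1r; apply: Wl. Qed.

Lemma submodZ (W : set V) : is_submod W -> forall a u, W u -> W (a *: u).
Proof. by move=> [W0 Wl] a u Wu; rewrite -[_ *: _]addr0; apply: Wl. Qed.

Lemma submodB (W : set V) : is_submod W -> forall u v, W u -> W v -> W (u - v).
Proof. by move=> [_ Wl] u v Wu Wv; rewrite addrC -scaleN1r; apply: Wl. Qed.

Lemma submod_sum (W : set V) I (r : seq I) (F : I -> V) :
  is_submod W -> (forall i, W (F i)) -> W (\sum_(i <- r) F i).
Proof.
move=> Ws WF; elim: r => [|i r IHr]; first by rewrite big_nil; case: Ws.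
by rewrite big_cons; apply: submodD.
Qed.

End Span.

(* Such an A is the free algebra on the [word [:: i]], presented so that the concrete
   monoid algebra never has to be unfolded. *)
Record word_basis (K : fieldType) (A : algType K) := WordBasis {
  word :> seq nat -> A;
  coef : A -> seq nat -> K;
  word_nil : word [::] = 1;
  wordM : forall u v, word u * word v = word (u ++ v);
  coef_word : forall u v, coef (word u) v = (u == v)%:R;
  coef_linear : forall a f g w, coef (a *: f + g) w = a * coef f w + coef g w;
  word_expand : forall f, exists s, f = \sum_(w <- s) coef f w *: word w
}.

Section Words.
Variables (K : fieldType) (A : algType K) (X : word_basis A).

Lemma wcoefD f g w : coef X (f + g) w = coef X f w + coef X g w.
Proof. by rewrite -[f]scale1r coef_linear mul1r scale1r. Qed.

Lemma wcoef0 w : coef X 0 w = 0.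
Proof. by apply: (addrI (coef X 0 w)); rewrite -wcoefD !addr0. Qed.

Lemma wcoefZ a f w : coef X (a *: f) w = a * coef X f w.
Proof. by rewrite -[_ *: _]addr0 coef_linear wcoef0 addr0. Qed.

Lemma wcoef_sum I (r : seq I) (F : I -> A) w :
  coef X (\sum_(i <- r) F i) w = \sum_(i <- r) coef X (F i) w.
Proof.
by elim/big_rec2: _ => [|i a b _ <-]; rewrite ?wcoef0 ?wcoefD.
Qed.

Lemma word_ind (P : A -> Prop) :
  P 0 -> (forall a f g, P f -> P g -> P (a *: f + g)) -> (forall w, P (X w)) ->
  forall f, P f.
Proof.
move=> P0 Pl Pw f; have [s ->] := word_expand X f.
elim: s => [|w r IHr]; first by rewrite big_nil.
by rewrite big_cons; apply: Pl.
Qed.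

Lemma wcoefB f g w : coef X (f - g) w = coef X f w - coef X g w.
Proof. by rewrite wcoefD -scaleN1r wcoefZ mulN1r. Qed.

Lemma eq_coef f g : (forall w, coef X f w = coef X g w) -> f = g.
Proof.
move=> fg; apply/eqP; rewrite -subr_eq0; apply/eqP.
have [s ->] := word_expand X (f - g).
by rewrite big1 // => w _; rewrite wcoefB fg subrr scale0r.
Qed.

Lemma word_cons i w : X (i :: w) = X [:: i] * X w.
Proof. by rewrite wordM. Qed.

Definition wcommutators (p : nat) : set A :=
  [set f | exists u s, size s = p /\ f = lcomm (X u) (map X s)]%classic.

Lemma comm0l (f : A) : comm 0 f = 0. Proof. by rewrite /comm mul0r mulr0 subrr. Qed.
Lemma comm0r (f : A) : comm f 0 = 0. Proof. by rewrite /comm mul0r mulr0 subrr. Qed.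
Lemma commDl (f g h : A) : comm (f + g) h = comm f h + comm g h.
Proof. by rewrite /comm mulrDl mulrDr opprD addrACA. Qed.
Lemma commDr (f g h : A) : comm h (f + g) = comm h f + comm h g.
Proof. by rewrite /comm mulrDl mulrDr opprD addrACA. Qed.
Lemma commZl a (f h : A) : comm (a *: f) h = a *: comm f h.
Proof. by rewrite /comm -scalerAl -scalerAr scalerBr. Qed.
Lemma commZr a (f h : A) : comm h (a *: f) = a *: comm h f.
Proof. by rewrite /comm -scalerAl -scalerAr scalerBr. Qed.

Lemma lcomm_rcons (B : pzRingType) (u : B) s v :
  lcomm u (rcons s v) = comm (lcomm u s) v.
Proof. by rewrite /lcomm foldl_rcons. Qed.

Lemma lcomm_wcommutators (u : A) s : lin_span (wcommutators (size s)) (lcomm u s).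
Proof.
elim/last_ind: s => [|s v IH].
  have [t ->] := word_expand X u.
  apply: (submod_sum _ (lin_span_submod _)) => w.
  apply: (submodZ (lin_span_submod _)).
  by apply: lin_span_sub; exists w, [::].
rewrite lcomm_rcons size_rcons.
have Ss := @lin_span_submod K A.
move: (lcomm u s) IH; apply: lin_span_ind.
- by rewrite comm0l; have [] := Ss (wcommutators (size s).+1).
- by move=> a f g If Ig; rewrite commDl commZl; apply: (proj2 (Ss _)).
move=> _ [w [t [st ->]]]; have [r ->] := word_expand X v.
rewrite (_ : comm _ _ = \sum_(i <- r) coef X v i *: comm (lcomm (X w) (map X t)) (X i)).
  apply: (submod_sum _ (Ss _)) => i; apply: (submodZ (Ss _)); apply: lin_span_sub.
  by exists w, (rcons t i); rewrite size_rcons st map_rcons lcomm_rcons.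
elim: r => [|i r IHr]; first by rewrite !big_nil comm0r.
by rewrite !big_cons commDr commZr IHr.
Qed.

Definition wideal_gens (p : nat) : set A :=
  [set f | exists a b u s,
    size s = p /\ f = X a * lcomm (X u) (map X s) * X b]%classic.

Lemma span_mull (S : set A) (f g : A) :
  (forall w h, S h -> S (X w * h)) -> lin_span S g -> lin_span S (f * g).
Proof.
move=> SX Sg; have Ss := lin_span_submod S.
move: f; apply: word_ind => [|a f1 f2 I1 I2|w].
- by rewrite mul0r; case: Ss.
- by rewrite mulrDl -scalerAl; apply: (proj2 Ss).
move: g Sg; apply: (@lin_span_ind K A) => [|a g1 g2 I1 I2|g Sg].
- by rewrite mulr0; case: Ss.
- by rewrite mulrDr -scalerAr; apply: (proj2 Ss).
by apply: lin_span_sub; apply: SX.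
Qed.

Lemma span_mulr (S : set A) (f g : A) :
  (forall w h, S h -> S (h * X w)) -> lin_span S g -> lin_span S (g * f).
Proof.
move=> SX Sg; have Ss := lin_span_submod S.
move: f; apply: word_ind => [|a f1 f2 I1 I2|w].
- by rewrite mulr0; case: Ss.
- by rewrite mulrDr -scalerAr; apply: (proj2 Ss).
move: g Sg; apply: (@lin_span_ind K A) => [|a g1 g2 I1 I2|g Sg].
- by rewrite mul0r; case: Ss.
- by rewrite mulrDl -scalerAl; apply: (proj2 Ss).
by apply: lin_span_sub; apply: SX.
Qed.

(** The span is closed under multiplication by words on both sides, hence is an ideal, and
    multilinearity of commutators puts the generators in it. Linear functionals therefore need
    testing only on commutators of words between two words. *)
Lemma comm_ideal_span p f : comm_ideal p.+1 f -> lin_span (wideal_gens p) f.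
Proof.
have Ss := lin_span_submod (wideal_gens p).
apply; split.
  split; first by case: Ss.
  - exact: submodB.
  - move=> a u; apply: span_mull => w _ [c [b [u0 [s [ss ->]]]]].
    by exists (w ++ c), b, u0, s; split; rewrite // !mulrA wordM.
  move=> a u; apply: span_mulr => w _ [c [b [u0 [s [ss ->]]]]].
  by exists c, (b ++ w), u0, s; split; rewrite // -!mulrA wordM.
move=> _ [u [s [[sp] ->]]].
have := @lcomm_wcommutators u s; rewrite sp.
move: (lcomm u s); apply: lin_span_ind; [by case: Ss|exact: (proj2 Ss)|].
move=> _ [w [t [st ->]]]; apply: lin_span_sub; exists [::], [::], w, t.
by rewrite word_nil mul1r mulr1.
Qed.

End Words.

Section Ideals.
Variables (A : pzRingType).

Lemma comm_ideal_lcomm (u : A) s : comm_ideal (size s).+1 (lcomm u s).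
Proof. by move=> J [_]; apply; exists u, s. Qed.

Lemma comm_idealS p : subset (@comm_ideal A p.+2) (comm_ideal p.+1).
Proof.
have Ii := ideal_gen_is_ideal (@commutators A p.+1).
move=> f; apply; split=> // _ [u [s [[sp] ->]]].
case/lastP: s sp => // s v; rewrite size_rcons => -[<-].
have [_ IB Il Ir] := ideal_gen_is_ideal (@commutators A (size s).+1).
rewrite lcomm_rcons; have Is := @comm_ideal_lcomm u s.
by apply: IB; [exact: Ir|exact: Il].
Qed.

End Ideals.

(** * Sign functionals *)

Section Signs.
Variable g : nat -> nat -> bool.
Hypothesis g_sym : symmetric g.

Definition inversions (U V : seq nat) : nat :=
  \sum_(a <- U) \sum_(b <- V) ((b < a)%N && g a b).

Definition crossing (U V : seq nat) : nat := \sum_(a <- U) \sum_(b <- V) g a b.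

(** [(-1) ^+ sgn w] is the sign picked up by sorting w when distinct letters a and b anticommute if
    [g a b] and commute otherwise. *)
Fixpoint sgn (w : seq nat) : nat :=
  if w is a :: w' then (inversions [:: a] w' + sgn w')%N else 0%N.

Lemma inversions_catl U V W :
  inversions (U ++ V) W = (inversions U W + inversions V W)%N.
Proof. by rewrite /inversions big_cat. Qed.

Lemma inversions_catr U V W :
  inversions W (U ++ V) = (inversions W U + inversions W V)%N.
Proof. by rewrite /inversions -big_split; apply: eq_bigr => a _; rewrite big_cat. Qed.

Lemma inversions_perm U U' V V' :
  perm_eq U U' -> perm_eq V V' -> inversions U V = inversions U' V'.
Proof.
move=> UU' VV'; rewrite /inversions (perm_big _ UU') /=.
by apply: eq_bigr => a _; apply: perm_big.
Qed.

Lemma sgn_cat u v : sgn (u ++ v) = (sgn u + sgn v + inversions u v)%N.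
Proof.
elim: u => [|a u IH] /=; first by rewrite /inversions big_nil addn0.
rewrite IH inversions_catr -[a :: u]/([:: a] ++ u) inversions_catl; lia.
Qed.

(** Two distinct letters, one from each word, are out of order in exactly one of UV and VU. *)
Lemma inversionsC U V : uniq (U ++ V) ->
  (inversions U V + inversions V U)%N = crossing U V.
Proof.
rewrite cat_uniq => /and3P[_ /hasPn UV _].
rewrite {2}/inversions exchange_big -big_split; apply: eq_big_seq => a aU /=.
rewrite -big_split; apply: eq_big_seq => b bV /=; rewrite g_sym.
have /negP nbU := UV _ bV.
have : a != b by apply/eqP => ab; apply: nbU; rewrite -ab.
by case: (ltngtP a b) => //= _ _; rewrite ?addn0 ?add0n.
Qed.

(** The nonvanishing criterion of [ell_lcomm]: each entry anticommutes with the product of all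
    entries before it. *)
Fixpoint steps (u : seq nat) (s : seq (seq nat)) : bool :=
  if s is v :: s' then odd (crossing u v) && steps (u ++ v) s' else true.

Lemma steps_rcons u s v :
  steps u (rcons s v) = steps u s && odd (crossing (u ++ flatten s) v).
Proof.
elim: s u => [|w s IH] u /=; first by rewrite cats0 andbT.
by rewrite IH -andbA catA.
Qed.

Section Functional.
Variables (K : fieldType) (A : algType K) (X : word_basis A).

Definition homog (U : seq nat) (f : A) : Prop :=
  forall w, coef X f w != 0 -> perm_eq w U.

Lemma homog_word U w : perm_eq w U -> homog U (X w).
Proof.
by move=> wU v; rewrite coef_word; have [<-//|_] := eqVneq w v; rewrite eqxx.
Qed.

Lemma homog0 U : homog U 0.
Proof. by move=> w; rewrite wcoef0 eqxx. Qed.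

Lemma homog_lin U a f h : homog U f -> homog U h -> homog U (a *: f + h).
Proof.
move=> Uf Uh w; rewrite coef_linear.
have [->|/Uf//] := eqVneq (coef X f w) 0; by rewrite mulr0 add0r => /Uh.
Qed.

Lemma homogD U f h : homog U f -> homog U h -> homog U (f + h).
Proof. by move=> Uf Uh; rewrite -[f]scale1r; apply: homog_lin. Qed.

Lemma homogB U f h : homog U f -> homog U h -> homog U (f - h).
Proof. by move=> Uf Uh; rewrite addrC -scaleN1r; apply: homog_lin. Qed.

Lemma homogZ U a f : homog U f -> homog U (a *: f).
Proof. by move=> Uf; rewrite -[_ *: _]addr0; apply: homog_lin => //; apply: homog0. Qed.

Lemma homog_perm U V f : perm_eq U V -> homog U f -> homog V f.
Proof. by move=> UV Uf w /Uf/perm_trans; apply. Qed.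

Lemma homog_ind U (P : A -> Prop) :
  P 0 -> (forall a f h, P f -> P h -> P (a *: f + h)) ->
  (forall w, perm_eq w U -> P (X w)) -> forall f, homog U f -> P f.
Proof.
move=> P0 Pl Pw f Uf; have [s ->] := word_expand X f.
elim: s => [|w s IH]; first by rewrite big_nil.
rewrite big_cons; have [->|/Uf wU] := eqVneq (coef X f w) 0.
  by rewrite scale0r add0r.
by apply: Pl => //; apply: Pw.
Qed.

Lemma homogM U V f h : homog U f -> homog V h -> homog (U ++ V) (f * h).
Proof.
move=> Uf Vh; move: f Uf; apply: homog_ind => [|a f1 f2 I1 I2|u uU].
- by rewrite mul0r; apply: homog0.
- by rewrite mulrDl -scalerAl; apply: homog_lin.
move: h Vh; apply: homog_ind => [|a f1 f2 I1 I2|v vV].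
- by rewrite mulr0; apply: homog0.
- by rewrite mulrDr -scalerAr; apply: homog_lin.
by rewrite wordM; apply/homog_word/perm_cat.
Qed.

Lemma homog_comm U V f h : homog U f -> homog V h -> homog (U ++ V) (comm f h).
Proof.
move=> Uf Vh; apply: homogB; first exact: homogM.
by apply: homog_perm (homogM Vh Uf); rewrite perm_catC.
Qed.

(** Reads off the coefficient of the sorted monomial after f, restricted to the rearrangements of W,
    is reordered by the sign rule. *)
Definition ell (W : seq nat) (f : A) : K :=
  \sum_(w <- permutations W) coef X f w * (-1) ^+ sgn w.

Lemma ell_lin W a f h : ell W (a *: f + h) = a * ell W f + ell W h.
Proof.
rewrite /ell mulr_sumr -big_split; apply: eq_bigr => w _ /=.
by rewrite coef_linear mulrDl mulrA.
Qed.

Lemma ell0 W : ell W 0 = 0.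
Proof. by rewrite /ell big1 // => w _; rewrite wcoef0 mul0r. Qed.

Lemma ellD W f h : ell W (f + h) = ell W f + ell W h.
Proof. by rewrite -[f]scale1r ell_lin mul1r scale1r. Qed.

Lemma ellZ W a f : ell W (a *: f) = a * ell W f.
Proof. by rewrite -[_ *: _]addr0 ell_lin ell0 addr0. Qed.

Lemma ellB W f h : ell W (f - h) = ell W f - ell W h.
Proof. by rewrite ellD -scaleN1r ellZ mulN1r. Qed.

Lemma ell_sum W I (r : seq I) (F : I -> A) :
  ell W (\sum_(i <- r) F i) = \sum_(i <- r) ell W (F i).
Proof. by elim/big_rec2: _ => [|i a b _ <-]; rewrite ?ell0 ?ellD. Qed.

Lemma ell_word W w : perm_eq w W -> ell W (X w) = (-1) ^+ sgn w.
Proof.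
move=> wW; rewrite /ell (bigD1_seq w) ?permutations_uniq ?mem_permutations //=.
rewrite coef_word eqxx mul1r big1 ?addr0 // => v vw.
by rewrite coef_word eq_sym (negPf vw) mul0r.
Qed.

Lemma ell_perm W W' f : perm_eq W W' -> ell W f = ell W' f.
Proof.
move=> WW'; apply: perm_big; apply: uniq_perm; rewrite ?permutations_uniq //.
move=> w; rewrite !mem_permutations; apply/idP/idP => /perm_trans; apply=> //.
by rewrite perm_sym.
Qed.

Lemma ell_homog0 U W f : homog U f -> ~~ perm_eq U W -> ell W f = 0.
Proof.
move=> Uf UW; rewrite /ell big_seq big1 // => w; rewrite mem_permutations => wW.
have [->|/Uf wU] := eqVneq (coef X f w) 0; first by rewrite mul0r.
by case/negP: UW; rewrite perm_sym in wU; apply: perm_trans wW.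
Qed.

Lemma ellM U V f h : homog U f -> homog V h ->
  ell (U ++ V) (f * h) = (-1) ^+ inversions U V * (ell U f * ell V h).
Proof.
move=> Uf Vh; move: f Uf; apply: homog_ind => [|a f1 f2 I1 I2|u uU].
- by rewrite mul0r !ell0 mul0r mulr0.
- by rewrite mulrDl -scalerAl !ell_lin I1 I2; ring.
move: h Vh; apply: homog_ind => [|a f1 f2 I1 I2|v vV].
- by rewrite mulr0 !ell0 !mulr0.
- by rewrite mulrDr -scalerAr !ell_lin I1 I2; ring.
rewrite wordM !ell_word ?perm_cat // sgn_cat -(inversions_perm uU vV).
by rewrite !exprD; ring.
Qed.

(** Exchanging the two factors costs the sign [(-1) ^+ crossing U V], so the two terms of the
    commutator either cancel or double. *)
Lemma ell_comm U V f h : homog U f -> homog V h -> uniq (U ++ V) ->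
  ell (U ++ V) (comm f h) =
    (-1) ^+ inversions U V * (1 - (-1) ^+ crossing U V) * (ell U f * ell V h).
Proof.
move=> Uf Vh UV; have VU : perm_eq (U ++ V) (V ++ U) by rewrite perm_catC.
rewrite ellB ellM // (ell_perm _ VU).
rewrite ellM // -(inversionsC UV) exprD.
have : (-1) ^+ inversions U V * (-1) ^+ inversions U V = 1 :> K.
  by rewrite -exprD addnn -mul2n exprM sqrrN !expr1n.
move: (_ ^+ inversions U V) ((-1) ^+ inversions V U) => i j ii.
have -> : i * (1 - i * j) = i - (i * i) * j by ring.
by rewrite ii; ring.
Qed.

Lemma homog_lcomm u s : homog (u ++ flatten s) (lcomm (X u) (map X s)).
Proof.
elim/last_ind: s => [|s v IH]; first by rewrite cats0; apply: homog_word.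
rewrite map_rcons lcomm_rcons flatten_rcons catA.
by apply: homog_comm => //; apply: homog_word.
Qed.

Lemma ell_lcomm u s : uniq (u ++ flatten s) ->
  ell (u ++ flatten s) (lcomm (X u) (map X s)) =
    if steps u s then (-1) ^+ sgn (u ++ flatten s) * 2 ^+ size s else 0.
Proof.
elim/last_ind: s => [|s v IH] => [_|].
  by rewrite cats0 /= mulr1 ell_word.
rewrite map_rcons lcomm_rcons flatten_rcons catA => us.
have Hl := @homog_lcomm u s; have Hv := @homog_word v v (perm_refl _).
rewrite ell_comm // steps_rcons IH; last by move: us; rewrite cat_uniq => /andP[].
case: (steps u s) => /=; last by rewrite mul0r mulr0.
rewrite ell_word // size_rcons exprS (sgn_cat (_ ++ _)) !exprD.
rewrite -[(-1) ^+ crossing _ _]signr_odd.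
by case: (odd _) => /=; rewrite ?expr1 ?expr0 /=; ring.
Qed.

Lemma ell_gens W c a u s b : uniq W ->
  ell W (X c * (X a * lcomm (X u) (map X s) * X b)) != 0 ->
  perm_eq ((u ++ flatten s) ++ c ++ a ++ b) W /\ steps u s.
Proof.
move=> uW; set f := _ * _.
have Hl := @homog_lcomm u s.
have Hw w := @homog_word w w (perm_refl w).
have Hf : homog (c ++ ((a ++ (u ++ flatten s)) ++ b)) f.
  by apply: homogM => //; apply: homogM => //; apply: homogM.
have pc : perm_eq (c ++ ((a ++ (u ++ flatten s)) ++ b)) ((u ++ flatten s) ++ c ++ a ++ b).
  by apply/permP => P; rewrite !count_cat; lia.
have [cW|/(ell_homog0 Hf)->] := boolP (perm_eq (c ++ ((a ++ (u ++ flatten s)) ++ b)) W);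
  last by rewrite eqxx.
move=> nz; split; first by apply: perm_trans cW; rewrite perm_sym.
have uf : uniq (u ++ flatten s).
  by move: uW; rewrite -(perm_uniq cW) (perm_uniq pc) cat_uniq => /andP[].
move: nz; rewrite -(ell_perm _ cW) /f ellM // ?ellM // ?ell_lcomm //; last 2 first.
- by apply: homogM.
- by apply: homogM => //; apply: homogM.
by case: steps => //; rewrite ?(mul0r, mulr0) eqxx.
Qed.

(** The word c is empty for showing that I_(p+1) is killed, and a single letter s for showing that
    x_s I_(p+1) is. *)
Lemma ell_ideal0 W c p : uniq W ->
  (forall u s r, size s = p -> perm_eq ((u ++ flatten s) ++ c ++ r) W ->
     ~~ steps u s) ->
  forall f, comm_ideal p.+1 f -> ell W (X c * f) = 0.
Proof.
move=> uW nst f /(@comm_ideal_span _ _ X); move: f.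
apply: (@lin_span_ind K A) => [|a f h If Ih|_ [a [b [u [s [sp ->]]]]]].
- by rewrite mulr0 ell0.
- by rewrite mulrDr -scalerAr ell_lin If Ih mulr0 addr0.
apply/eqP; apply: contraT => /(ell_gens uW)[/(nst _ _ _ sp)].
by case: steps.
Qed.

End Functional.
End Signs.

(** * Graphs given by parities and links, and the bound on the number of steps *)

Lemma odd_sum_addb (I : Type) (r : seq I) (F G H : I -> nat) :
  (forall i, odd (F i) = odd (G i) (+) odd (H i)) ->
  odd (\sum_(i <- r) F i) = odd (\sum_(i <- r) G i) (+) odd (\sum_(i <- r) H i).
Proof.
move=> FGH; elim: r => [|i r IH]; first by rewrite !big_nil.
by rewrite !big_cons !oddD FGH IH addbACA.
Qed.

Section Potential.
Variables (par : nat -> bool) (kap : nat -> nat) (m : nat).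
Hypothesis kap_le : forall a, (kap a <= m)%N.

(** Class 0 collects the unlinked letters; every other class is meant to be one link. *)
Definition linked (a b : nat) : bool := (kap a != 0%N) && (kap a == kap b).

Definition graph (a b : nat) : bool := (par a && par b) (+) linked a b.

Lemma graph_sym : symmetric graph.
Proof.
move=> a b; rewrite /graph /linked andbC; congr (_ (+) _).
by have [->//|] := eqVneq (kap a) (kap b); rewrite ?andbF.
Qed.

Definition odds (w : seq nat) : nat := count par w.
Definition class (c : nat) (w : seq nat) : nat := count (fun a => kap a == c) w.
(** When no class from 1 to m has more than two letters, this counts the links with both ends in
    w. *)
Definition full (w : seq nat) : nat := \sum_(1 <= c < m.+1) (1 < class c w)%N.

(** Modulo 2 the crossings split into pairs of odd letters, counted by one product, and linked
    pairs, counted class by class. *)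
Lemma odd_crossing u v : odd (crossing graph u v) =
  (odd (odds u) && odd (odds v)) (+)
  odd (\sum_(1 <= c < m.+1) class c u * class c v)%N.
Proof.
have -> : (\sum_(1 <= c < m.+1) class c u * class c v)%N =
    (\sum_(a <- u) \sum_(b <- v) linked a b)%N.
  under eq_bigr => c _.
    rewrite /class -!sum1_count big_distrlr /= big_mkcond /=.
    under eq_bigr => a _ do rewrite big_mkcond /=.
    over.
  rewrite exchange_big; apply: eq_bigr => a _ /=.
  transitivity (\sum_(1 <= c < m.+1) \sum_(b <- v) ((kap a == c) && (kap b == c) : nat))%N.
    apply: eq_bigr => c _; case: eqP => /= _; last by rewrite big1.
    by apply: eq_bigr => b _; case: eqP.
  rewrite exchange_big; apply: eq_bigr => b _ /=; rewrite /linked.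
  have [a0|a0] /= := eqVneq (kap a) 0%N.
    by rewrite big_nat big1 // a0 => -[].
  rewrite (bigD1_seq (kap a)) ?iota_uniq ?mem_index_iota ?lt0n ?a0 ?ltnS //=.
  rewrite eqxx eq_sym big1 ?addn0 // => c; by rewrite eq_sym => /negPf->.
have -> : odd (odds u) && odd (odds v) =
    odd (\sum_(a <- u) \sum_(b <- v) (par a && par b))%N.
  rewrite -oddM /odds -!sum1_count big_distrlr /= big_mkcond /=; congr odd.
  apply: eq_bigr => a _; case: (par a) => /=; last by rewrite big1.
  by rewrite big_mkcond; apply: eq_bigr => b _; case: (par b).
apply: odd_sum_addb => a; apply: odd_sum_addb => b.
by rewrite /graph; case: (_ && _); case: linked.
Qed.

Lemma class_cat c u v : class c (u ++ v) = (class c u + class c v)%N.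
Proof. exact: count_cat. Qed.

Lemma full_le w : (full w <= m)%N.
Proof.
rewrite (leq_trans (n := \sum_(1 <= c < m.+1) 1)) //; last by rewrite sum_nat_const_nat; lia.
by apply: leq_sum => c _; exact: leq_b1.
Qed.

Lemma full_lt w c : (0 < c <= m)%N -> (class c w <= 1)%N -> (full w < m)%N.
Proof.
move=> cm cw; rewrite /full (bigD1_seq c) ?iota_uniq ?mem_index_iota //=.
rewrite [(1 < _)%N]ltnNge cw add0n.
have : (\sum_(1 <= d < m.+1) 1 = m)%N by rewrite sum_nat_const_nat; lia.
rewrite (bigD1_seq c) ?iota_uniq ?mem_index_iota //= => {2}<-.
by rewrite add1n ltnS; apply: leq_sum => d _; exact: leq_b1.
Qed.

Lemma full_catl u v : (full u <= full (u ++ v))%N.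
Proof.
apply: leq_sum => c _; rewrite class_cat.
by case: (ltnP 1 (class c u)) => // cu; rewrite (leq_trans cu) ?leq_addr.
Qed.

(** An odd sum has an odd term. As a class has at most two letters, the corresponding link has one
    end in u and the other in v, so it becomes full. *)
Lemma full_step u v :
  (forall c, (0 < c)%N -> class c (u ++ v) <= 2)%N ->
  odd (\sum_(1 <= c < m.+1) class c u * class c v)%N ->
  (full u < full (u ++ v))%N.
Proof.
move=> c2 os.
have /hasP[c cm oc] : has (fun c => odd (class c u * class c v)) (index_iota 1 m.+1).
  apply: contraTT os => /hasPn no; rewrite big_seq.
  by elim/big_rec: _ => // c x /no; rewrite oddD => /negPf-> /negPf->.
rewrite /full !(bigD1_seq c) ?iota_uniq //= -addSn.
have := c2 c; move: cm; rewrite mem_index_iota class_cat => /andP[c0 _] /(_ c0) c2'.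
have [cu cv] : (class c u = 1 /\ class c v = 1)%N by move: oc; rewrite oddM; lia.
rewrite cu cv leq_add //; apply: leq_sum => d _; rewrite class_cat.
by case: (ltnP 1 (class d u)) => // cu'; rewrite (leq_trans cu') ?leq_addr.
Qed.

(* A step that uses up a link raises the first summand by at least 2 and lowers the
   evenness indicator by at most 1; any other step raises the indicator by 1. *)
Lemma steps_potential u s :
  (forall c, (0 < c)%N -> class c (u ++ flatten s) <= 2)%N -> steps graph u s ->
  let w := u ++ flatten s in
  ((full u).*2 + ~~ odd (odds u) + size s <= (full w).*2 + ~~ odd (odds w))%N /\
  ((full u).*2 + ~~ odd (odds u) + odds u + (size s).*2 <=
     (full w).*2 + ~~ odd (odds w) + odds w)%N.
Proof.
elim: s u => [|v s IH] u /= c2; first by rewrite cats0 !addn0.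
rewrite catA in c2 *; case/andP=> cuv /(IH _ c2) {IH} /=.
have {}c2 c : (0 < c)%N -> (class c (u ++ v) <= 2)%N.
  by move/c2; apply: leq_trans; rewrite [in leqRHS]class_cat leq_addr.
have Fuv := full_catl u v; have := @full_step u v c2.
move: cuv; rewrite odd_crossing.
have -> : odds (u ++ v) = (odds u + odds v)%N by apply: count_cat.
case: (odd (\sum_(_ <= _ < _) _)) => /= [|+ _]; rewrite ?oddD.
  move=> + /(_ isT); move: (full _) (full _) (full _) Fuv => x y z; lia.
move: (full _) (full _) (full _) Fuv => x y z; lia.
Qed.

(** The first bound is the potential, which is at most 2 [full w] + 1. For the second, the number of
    odd letters is added to the potential: each step then gains at least 2, because a step that
    raises the potential by only 1 brings in an odd number of odd letters. The initial value of this
    sum is at least 1, which absorbs the evenness indicator at the end. *)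
Lemma steps_bound u s :
  (forall c, (0 < c)%N -> class c (u ++ flatten s) <= 2)%N -> steps graph u s ->
  let w := u ++ flatten s in
  (size s <= (full w).*2.+1)%N /\ (size s <= full w + (odds w)./2)%N.
Proof.
move=> c2 /(steps_potential c2) /=; move: (full _) (full _) => x y.
move: (odds _) (odds _) => p q; lia.
Qed.

End Potential.

Lemma perm_swap02 (i j a b : nat) : perm_eq [:: i; a; j; b] [:: j; a; i; b].
Proof. by apply/permP => p /=; lia. Qed.

Lemma perm_swap12 (i j a b : nat) : perm_eq [:: i; a; j; b] [:: i; j; a; b].
Proof. by apply/permP => p /=; lia. Qed.

(** * Dual families of proper polynomials *)

Section Blocks.
Variables (K : fieldType) (A : algType K) (X : word_basis A).
Hypothesis two_neq0 : (2 : K) != 0.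
Local Notation x i := (X [:: i]).

(* For odd, unlinked a and b the sign functional is nonzero on Q iff i and j are
   linked and both odd, on R iff they are linked and not both odd, and on P iff
   they are linked and i is odd. *)
Definition blockQ (i j a b : nat) : A :=
  comm (x i) (x a) * comm (x j) (x b) + comm (x j) (x a) * comm (x i) (x b).

Definition blockR (i j a b : nat) : A :=
  2 *: (comm (x i) (x j) * comm (x a) (x b)) +
  (comm (x i) (x a) * comm (x j) (x b) - comm (x j) (x a) * comm (x i) (x b)).

Definition blockP (i j a : nat) : A := lcomm (x i) [:: x a; x j].

Lemma homog_x i : homog X [:: i] (x i).
Proof. by apply: homog_word. Qed.

Lemma homog_comm_x i j : homog X [:: i; j] (comm (x i) (x j)).
Proof. by rewrite -[[:: i; j]]/([:: i] ++ [:: j]); apply: homog_comm; apply: homog_x. Qed.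

Lemma homog_comm_comm i j a b :
  homog X [:: i; j; a; b] (comm (x i) (x j) * comm (x a) (x b)).
Proof.
rewrite -[[:: i; j; a; b]]/([:: i; j] ++ [:: a; b]).
by apply: homogM; apply: homog_comm_x.
Qed.

Lemma homog_blockQ i j a b : homog X [:: i; a; j; b] (blockQ i j a b).
Proof.
apply: homogD; first exact: homog_comm_comm.
refine (homog_perm _ (@homog_comm_comm _ _ _ _)).
by rewrite perm_sym; apply: perm_swap02.
Qed.

Lemma homog_blockR i j a b : homog X [:: i; a; j; b] (blockR i j a b).
Proof.
apply: homogD; last first.
  apply: homogB; first exact: homog_comm_comm.
  refine (homog_perm _ (@homog_comm_comm _ _ _ _)).
  by rewrite perm_sym; apply: perm_swap02.
apply: homogZ; refine (homog_perm _ (@homog_comm_comm _ _ _ _)).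
by rewrite perm_sym; apply: perm_swap12.
Qed.

Lemma homog_blockP i j a : homog X [:: i; a; j] (blockP i j a).
Proof.
rewrite -[[:: i; a; j]]/([:: i; a] ++ [:: j]).
by apply: homog_comm; [exact: homog_comm_x|exact: homog_x].
Qed.

Section Values.
Variable g : nat -> nat -> bool.
Hypothesis g_sym : symmetric g.

Lemma sgn_swap u y z v : y != z ->
  (-1) ^+ sgn g (u ++ y :: z :: v) =
    (-1) ^+ g y z * (-1) ^+ sgn g (u ++ z :: y :: v) :> K.
Proof.
move=> yz; rewrite -signr_odd -[in RHS](signr_odd _ (sgn _ _)) -signr_addb.
congr (_ ^+ nat_of_bool _).
have P : perm_eq (y :: z :: v) (z :: y :: v) by apply/permP => p /=; rewrite addnCA.
rewrite !sgn_cat (inversions_perm _ (perm_refl u) P) /=.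
have split1 w w' : inversions g [:: w] (w' :: v) =
    (inversions g [:: w] [:: w'] + inversions g [:: w] v)%N.
  by rewrite -inversions_catr.
rewrite !split1.
have /(inversionsC g_sym) : uniq ([:: y] ++ [:: z]) by rewrite /= inE yz.
rewrite /crossing !big_seq1; move: (inversions g [:: y] [:: z]) (inversions g [:: z] [:: y]) => p q.
rewrite !oddD => /(congr1 odd); rewrite oddD oddb => <-.
move: (odd p) (odd q) (odd (sgn g u)) (odd (sgn g v)) (odd (inversions g u _)).
move: (odd (inversions g [:: y] v)) (odd (inversions g [:: z] v)).
by do 7 case.
Qed.

Lemma ell_x i : ell g X [:: i] (x i) = 1.
Proof. by rewrite ell_word //= /sgn /inversions big_seq1 big_nil expr0. Qed.

Lemma ell_comm_x i j : i != j ->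
  ell g X [:: i; j] (comm (x i) (x j)) = (-1) ^+ sgn g [:: i; j] * (1 - (-1) ^+ g i j).
Proof.
move=> ij; have := ell_comm g_sym (@homog_x i) (@homog_x j).
rewrite /= inE ij => /(_ isT) ->; rewrite !ell_x !mulr1 /crossing !big_seq1.
by rewrite /inversions !big_seq1 big_nil !addn0.
Qed.

Lemma ell_comm_comm i j a b : i != j -> a != b ->
  ell g X [:: i; j; a; b] (comm (x i) (x j) * comm (x a) (x b)) =
    (-1) ^+ sgn g [:: i; j; a; b] * ((1 - (-1) ^+ g i j) * (1 - (-1) ^+ g a b)).
Proof.
move=> ij ab.
rewrite -[[:: i; j; a; b]]/([:: i; j] ++ [:: a; b]) ellM; try exact: homog_comm_x.
by rewrite !ell_comm_x // sgn_cat !exprD; ring.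
Qed.

Lemma one_sub_sign (e : bool) : 1 - (-1) ^+ e = (if e then 2 else 0) :> K.
Proof. by case: e; rewrite ?expr1 ?expr0 ?subrr // opprK. Qed.

Lemma one_add_sign (e : bool) : 1 + (-1) ^+ e = (if e then 0 else 2) :> K.
Proof. by case: e; rewrite ?expr1 ?expr0 ?subrr. Qed.

Local Arguments sgn : simpl never.

Section OddAux.
Variables (i j a b : nat) (oi oj : bool).
Hypothesis uijab : uniq [:: i; j; a; b].
Hypotheses (gia : g i a = oi) (gib : g i b = oi).
Hypotheses (gja : g j a = oj) (gjb : g j b = oj) (gab : g a b = true).

Lemma sgn_swap02 : (-1) ^+ sgn g [:: j; a; i; b] =
  (-1) ^+ oj * (-1) ^+ oi * (-1) ^+ g i j * (-1) ^+ sgn g [:: i; a; j; b] :> K.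
Proof.
move: uijab; rewrite /= !inE !negb_or => /and4P[/and3P[ij ia ib] /andP[ja jb] ab _].
rewrite (@sgn_swap [::] j a [:: i; b]) // (@sgn_swap [:: a] j i [:: b]) 1?eq_sym //.
rewrite /= (@sgn_swap [::] a i [:: j; b]) 1?eq_sym // gja [g a i]g_sym gia.
by rewrite [g j i]g_sym; ring.
Qed.

(** Both products survive only if i and j are odd; exchanging i and j then changes the sign exactly
    when [g i j], so the sum survives when [g i j] is false. *)
Lemma ell_blockQ : (ell g X [:: i; a; j; b] (blockQ i j a b) == 0) =
  ~~ [&& oi, oj & ~~ g i j].
Proof.
move: uijab; rewrite /= !inE !negb_or => /and4P[/and3P[ij ia ib] /andP[ja jb] ab _].
rewrite ellD ell_comm_comm // (@ell_perm _ _ _ _ [:: i; a; j; b] [:: j; a; i; b]); last first.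
  exact: perm_swap02.
rewrite ell_comm_comm // sgn_swap02.
rewrite gia gib gja gjb.
set s := _ ^+ _; have s0 : s != 0 by rewrite signr_eq0.
have -> : forall e u v : K, s * (u * v) + e * s * (v * u) = s * (u * v * (1 + e)).
  by move=> *; ring.
rewrite mulf_eq0 (negPf s0) /=.
rewrite -!signr_addb !one_sub_sign one_add_sign !mulf_eq0.
by case: oi; case: oj; case: (g i j); rewrite /= ?(eqxx, negPf two_neq0).
Qed.

(** If i or j is even, the last two products vanish and [x_i, x_j][x_a, x_b] detects [g i j]. If
    both are odd, everything vanishes when [g i j] is false; otherwise the difference contributes 8
    and the first product -8, up to a common sign, which dictates the coefficient 2. *)
Lemma ell_blockR : (ell g X [:: i; a; j; b] (blockR i j a b) == 0) =
  (oi && oj) || ~~ ((oi && oj) (+) g i j).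
Proof.
move: uijab; rewrite /= !inE !negb_or => /and4P[/and3P[ij ia ib] /andP[ja jb] ab _].
rewrite ellD ellZ ellB ell_comm_comm //.
rewrite (@ell_perm _ _ _ _ [:: i; a; j; b] [:: i; j; a; b]); last exact: perm_swap12.
rewrite (@ell_perm _ _ _ _ [:: i; a; j; b] [:: j; a; i; b]); last first.
  exact: perm_swap02.
rewrite !ell_comm_comm // sgn_swap02.
rewrite (@sgn_swap [:: i] j a [:: b]) // gia gib gja gjb gab /=.
set s := (-1) ^+ sgn _ _; have s0 : s != 0 by rewrite signr_eq0.
rewrite -!signr_addb !one_sub_sign.
case: oi; case: oj; case: (g i j); rewrite /= ?(mul0r, mulr0, subr0, addr0, eqxx) //.
all: rewrite ?expr1 ?expr0 ?mul1r ?mulN1r ?opprK -?[1 + 1]/2.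
all: try by rewrite !(mulf_eq0, oppr_eq0) (negPf two_neq0) (negPf s0).
all: apply/eqP; ring.
Qed.

End OddAux.

(** The inner commutator survives iff [g i a]; bracketing with j then survives iff j anticommutes
    with exactly one of i and a. *)
Lemma ell_blockP i j a (oi oj : bool) : uniq [:: i; a; j] ->
  g i a = oi -> g a j = oj ->
  (ell g X [:: i; a; j] (blockP i j a) == 0) = ~~ (oi && (g i j (+) oj)).
Proof.
move=> u gia gaj; rewrite /blockP /lcomm /=.
rewrite -[[:: i; a; j]]/([:: i; a] ++ [:: j]).
rewrite (ell_comm g_sym (@homog_comm_x i a) (@homog_x j)) //.
rewrite ell_comm_x; last by move: u; rewrite /= !inE negb_or => /and3P[/andP[]].
rewrite ell_x gia !mulf_eq0 !signr_eq0 oner_eq0 orbF /=.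
rewrite /crossing !big_cons !big_nil !addn0 -[_ ^+ (_ + _)]signr_odd oddD !oddb gaj.
rewrite !one_sub_sign.
by clear gia gaj; case: oi; case: (_ (+) _); rewrite /= ?(eqxx, negPf two_neq0).
Qed.

End Values.
End Blocks.

(** * Proper polynomials and products of blocks *)

Section Proper.
Variables (K : fieldType) (A : algType K) (X : word_basis A).

Definition lcomm_vars (c : nat * seq nat) : A :=
  lcomm (X [:: c.1]) [seq X [:: i] | i <- c.2].

Definition lcomm_prods : set A :=
  [set f | exists2 cs : seq (nat * seq nat), all (fun c => 0 < size c.2)%N cs &
     f = \prod_(c <- cs) lcomm_vars c]%classic.

Definition proper : set A := lin_span lcomm_prods.

Lemma proper_submod : is_submod proper.
Proof. exact: lin_span_submod. Qed.

Lemma proper_lcomm c : (0 < size c.2)%N -> proper (lcomm_vars c).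
Proof.
move=> c0; apply: lin_span_sub; exists [:: c]; first by rewrite /= c0.
by rewrite big_seq1.
Qed.

Lemma properM f h : proper f -> proper h -> proper (f * h).
Proof.
have [P0 Pl] := proper_submod.
move=> Pf Ph; move: f Pf; apply: (@lin_span_ind K A) => [|a f1 f2 I1 I2|f [cs cs0 ->]].
- by rewrite mul0r.
- by rewrite mulrDl -scalerAl; apply: Pl.
move: h Ph; apply: (@lin_span_ind K A) => [|a f1 f2 I1 I2|h [ds ds0 ->]].
- by rewrite mulr0.
- by rewrite mulrDr -scalerAr; apply: Pl.
apply: lin_span_sub; exists (cs ++ ds); first by rewrite all_cat cs0.
by rewrite big_cat.
Qed.

Lemma proper1 : proper 1.
Proof. by apply: lin_span_sub; exists [::]; rewrite // big_nil. Qed.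

Lemma proper_comm i j : proper (comm (X [:: i]) (X [:: j])).
Proof. exact: (@proper_lcomm (i, [:: j])). Qed.

Lemma proper_blockP i j a : proper (blockP X i j a).
Proof. exact: (@proper_lcomm (i, [:: a; j])). Qed.

Lemma proper_blockQ i j a b : proper (blockQ X i j a b).
Proof. by apply: (submodD proper_submod); apply: properM; apply: proper_comm. Qed.

Lemma proper_blockR i j a b : proper (blockR X i j a b).
Proof.
apply: (submodD proper_submod); first apply: (submodZ proper_submod).
  by apply: properM; apply: proper_comm.
by apply: (submodB proper_submod); apply: properM; apply: proper_comm.
Qed.

Lemma proper_prod (bs : seq (seq nat * A)) :
  (forall b, b \in bs -> proper b.2) -> proper (\prod_(b <- bs) b.2).
Proof.
elim: bs => [|b bs IH] Pb; first by rewrite big_nil; apply: proper1.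
rewrite big_cons; apply: properM; first by apply: Pb; rewrite mem_head.
by apply: IH => c cb; apply: Pb; rewrite inE cb orbT.
Qed.

End Proper.

Section BlockProducts.
Variables (K : fieldType) (A : algType K) (X : word_basis A).

Lemma homog_prod (bs : seq (seq nat * A)) :
  (forall b, b \in bs -> homog X b.1 b.2) ->
  homog X (flatten (unzip1 bs)) (\prod_(b <- bs) b.2).
Proof.
elim: bs => [|b bs IH] Hb.
  by rewrite big_nil -(word_nil X); apply: homog_word.
rewrite big_cons; apply: homogM; first by apply: Hb; rewrite mem_head.
by apply: IH => c cb; apply: Hb; rewrite inE cb orbT.
Qed.

Lemma ell_prod_eq0 g (bs : seq (seq nat * A)) :
  (forall b, b \in bs -> homog X b.1 b.2) ->
  (ell g X (flatten (unzip1 bs)) (\prod_(b <- bs) b.2) == 0) =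
  has (fun b => ell g X b.1 b.2 == 0) bs.
Proof.
elim: bs => [|b bs IH] Hb.
  by rewrite big_nil -(word_nil X) ell_word //= expr0 oner_eq0.
have Hbs c : c \in bs -> homog X c.1 c.2 by move=> cb; apply: Hb; rewrite inE cb orbT.
rewrite big_cons /= ellM; last 2 first.
- by apply: Hb; rewrite mem_head.
- exact: homog_prod.
by rewrite !mulf_eq0 signr_eq0 IH.
Qed.

Fixpoint pairup (s : seq nat) : seq (seq nat * A) :=
  if s is y :: z :: s' then
    ([:: y; z], comm (X [:: y]) (X [:: z])) :: pairup s'
  else [::].

Lemma pair_ind (P : seq nat -> Prop) :
  P [::] -> (forall y, P [:: y]) -> (forall y z s, P s -> P (y :: z :: s)) ->
  forall s, P s.
Proof.
move=> P0 P1 P2 s; have [n] := ubnP (size s); elim: n s => // n IH [|y [|z s]] //= sn.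
by apply/P2/IH; rewrite -ltnS; apply: leq_trans sn; rewrite ltnS leqnSn.
Qed.

Lemma flatten_pairup s : ~~ odd (size s) -> flatten (unzip1 (pairup s)) = s.
Proof.
by move: s; apply: pair_ind => //= y z s IH; rewrite negbK => /IH->.
Qed.

Lemma mem_pairup s b : uniq s -> b \in pairup s ->
  exists y z, [/\ y \in s, z \in s, y != z & b = ([:: y; z], comm (X [:: y]) (X [:: z]))].
Proof.
move: s; apply: pair_ind => //= y z s IH /and3P[yzs zs us].
rewrite inE => /orP[/eqP->|/(IH us)[y' [z' [ys' zs' yz' ->]]]].
  exists y, z; rewrite !inE !eqxx orbT; split=> //.
  by move: yzs; rewrite inE negb_or => /andP[].
by exists y', z'; rewrite !inE ys' zs' !orbT.
Qed.

End BlockProducts.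

(** * The functional and the proper polynomial of a matching *)

Section Family.
Variables (n m : nat) (t : bool).
Hypothesis n_large : (2 * m <= n)%N.
Local Notation N := (n - 2 * m)%N.
Implicit Types (M B : seq (nat * nat)) (e : nat * nat).

Definition letters M : seq nat := flatten [seq [:: e.1; e.2] | e <- M].

(** The top 2m letters are kept out of the pairs: they are reserved as auxiliary letters, two for
    each block. *)
Definition matching M : Prop :=
  [/\ size M = m, uniq (letters M) & all (fun i => i < N)%N (letters M)].

(* Any letter depending only on the set of letters of M would do. *)
Definition special M : nat := head 0%N [seq i <- iota 0 n | i \in letters M].

(* For odd n exactly one pair has letters of different parities: the corresponding
   block has three letters instead of four, which leaves an even number of letters
   to be paired up in [rest]. *)
Definition mixed M e : bool := t && (special M \in [:: e.1; e.2]).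

Definition pair_index M i : nat := find (fun e => i \in [:: e.1; e.2]) M.

Definition pair_class M i : nat :=
  if i \in letters M then (pair_index M i).+1 else 0%N.

(** The parities encode the order of a pair: both letters odd if it is increasing, both even if
    decreasing. In the mixed pair the first letter is the odd one. Letters outside the pairs are
    odd. *)
Definition pair_parity M i : bool :=
  if i \in letters M then
    let e := nth (0, 0)%N M (pair_index M i) in
    if mixed M e then i == e.1 else (e.1 < e.2)%N
  else true.

Lemma mem_letters M i : reflect (exists2 e, e \in M & i \in [:: e.1; e.2]) (i \in letters M).
Proof.
apply: (iffP flattenP) => [[_ /mapP[e eM ->] ie]|[e eM ie]]; first by exists e.
by exists [:: e.1; e.2] => //; apply: map_f.
Qed.

Lemma pair_index_lt M i : (pair_index M i < size M)%N = (i \in letters M).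
Proof.
rewrite -has_find; apply/hasP/mem_letters => [[e eM ie]|[e eM ie]]; by exists e.
Qed.

Lemma pair_indexP M i : i \in letters M ->
  let e := nth (0, 0)%N M (pair_index M i) in e \in M /\ i \in [:: e.1; e.2].
Proof.
move=> iM /=; split; first by rewrite mem_nth ?pair_index_lt.
have /(nth_find (0, 0)%N) // : has (fun e => i \in [:: e.1; e.2]) M.
by rewrite has_find [X in (X < _)%N]/(pair_index M i) pair_index_lt.
Qed.

Lemma letters_cons e M : letters (e :: M) = e.1 :: e.2 :: letters M.
Proof. by []. Qed.

Lemma pair_index_mem M e i : uniq (letters M) -> e \in M -> i \in [:: e.1; e.2] ->
  pair_index M i = index e M.
Proof.
elim: M => // e' M IH; rewrite letters_cons [uniq _]/= => /and3P[e1 e2 uM].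
rewrite inE /pair_index /=; have [->|ne] /= := eqVneq e e'; first by move=> _ ->.
move=> eM ie; case: ifP => ie'; last by rewrite -/(pair_index M i) (IH uM eM ie).
have iM : i \in letters M by apply/mem_letters; exists e.
move: e1; rewrite inE negb_or => /andP[_ e1].
by move: ie'; rewrite !inE => /orP[]/eqP ii; move: e1 e2; rewrite -ii iM.
Qed.

Lemma nth_pair_index M e i : uniq (letters M) -> e \in M -> i \in [:: e.1; e.2] ->
  nth (0, 0)%N M (pair_index M i) = e.
Proof. by move=> uM eM ie; rewrite (pair_index_mem uM eM ie) nth_index. Qed.

Lemma pair_class_le M i : (pair_class M i <= size M)%N.
Proof. by rewrite /pair_class; case: ifP => //; rewrite -pair_index_lt. Qed.

Lemma uniq_letters_neq M e : uniq (letters M) -> e \in M -> e.1 != e.2.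
Proof.
elim: M => // e' M IH; rewrite letters_cons inE => /= /and3P[e1 _ uM] /orP[/eqP->|/IH//]; last exact.
by move: e1; rewrite inE negb_or => /andP[].
Qed.

Lemma uniq_letters M : uniq (letters M) -> uniq M.
Proof.
elim: M => // e M IH; rewrite letters_cons => /= /and3P[e1 _ /IH->]; rewrite andbT.
apply: contra e1 => eM; rewrite inE; apply/orP; right.
by apply/mem_letters; exists e; rewrite ?inE ?eqxx.
Qed.

Lemma linked_pair M e : uniq (letters M) -> e \in M ->
  linked (pair_class M) e.1 e.2.
Proof.
move=> uM eM; have [e1 e2] : e.1 \in letters M /\ e.2 \in letters M.
  by split; apply/mem_letters; exists e; rewrite ?inE ?eqxx ?orbT.
rewrite /linked /pair_class e1 e2 /= eqSS.
by rewrite !(pair_index_mem uM eM) ?inE ?eqxx ?orbT.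
Qed.

Lemma linked_mem M i j : linked (pair_class M) i j -> i != j ->
  [/\ i \in letters M, j \in letters M & ((i, j) \in M) || ((j, i) \in M)].
Proof.
rewrite /linked /pair_class; case: ifP => // iM; case: ifP => // jM.
rewrite /= eqSS => /eqP ij nij; split=> //.
have [eM ie] := pair_indexP iM; have [_ je] := pair_indexP jM; rewrite -ij in je.
case: (nth _ _ _) eM ie je nij => p q; rewrite !inE /= => pqM.
by move=> /orP[]/eqP-> /orP[]/eqP->; rewrite ?eqxx ?pqM ?orbT.
Qed.

Lemma size_letters M : size (letters M) = (size M).*2.
Proof. by elim: M => // e M IH; rewrite letters_cons /= IH. Qed.

Lemma class_le2 M W c : uniq W -> (0 < c)%N -> (class (pair_class M) c W <= 2)%N.
Proof.
move=> uW c0; rewrite /class -size_filter.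
pose e := nth (0, 0)%N M c.-1.
have us : uniq [seq a <- W | pair_class M a == c] by apply: filter_uniq.
apply: (uniq_leq_size us (s2 := [:: e.1; e.2])) => a.
rewrite mem_filter /pair_class => /andP[+ _]; case: ifP => [aM|_ /eqP c0']; last by rewrite -c0' in c0.
by move=> /eqP ac; have [_] := pair_indexP aM; rewrite /e -ac.
Qed.

Section Element.
Variables (K : fieldType) (A : algType K) (X : word_basis A).

(* The letters from N on never occur in a pair, so the auxiliary a and b are odd and
   unlinked for the functional of every matching. *)
Definition block M e l : seq nat * A :=
  let i := e.1 in let j := e.2 in
  let a := (N + l.*2)%N in let b := (N + l.*2.+1)%N in
  if mixed M e then ([:: i; a; j], blockP X i j a)
  else ([:: i; a; j; b],
        if (i < j)%N then blockQ X i j a b else blockR X i j a b).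

Definition main_blocks M : seq (seq nat * A) :=
  [seq block M el.1 el.2 | el <- zip M (iota 0 (size M))].

Definition used M : seq nat := flatten (unzip1 (main_blocks M)).

Definition rest M : seq nat := [seq i <- iota 0 n | i \notin used M].

Definition blocks M := main_blocks M ++ pairup X (rest M).

Definition matching_poly M : A := \prod_(b <- blocks M) b.2.

Lemma homog_block M e l : homog X (block M e l).1 (block M e l).2.
Proof.
rewrite /block; case: mixed => /=; first exact: homog_blockP.
by case: ifP => _ /=; [exact: homog_blockQ|exact: homog_blockR].
Qed.

Lemma homog_blocks M b : b \in blocks M -> homog X b.1 b.2.
Proof.
rewrite mem_cat => /orP[/mapP[[e l] _ ->]|]; first exact: homog_block.
have ur : uniq (rest M) by rewrite filter_uniq ?iota_uniq.
move=> /(mem_pairup ur)[y [z [_ _ _ ->]]]; exact: homog_comm_x.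
Qed.

Lemma proper_matching_poly M : proper X (matching_poly M).
Proof.
apply: proper_prod => b; rewrite mem_cat => /orP[/mapP[[e l] _ ->]|].
  rewrite /block; case: mixed => /=; first exact: proper_blockP.
  by case: ifP => _ /=; [exact: proper_blockQ|exact: proper_blockR].
have ur : uniq (rest M) by rewrite filter_uniq ?iota_uniq.
move=> /(mem_pairup ur)[y [z [_ _ _ ->]]]; exact: proper_comm.
Qed.

Definition aux l := [:: (N + l.*2)%N; (N + l.*2.+1)%N].

Lemma flatten_aux k p : flatten [seq aux l | l <- iota k p] = iota (N + k.*2) p.*2.
Proof.
elim: p k => // p IH k; rewrite /= IH doubleS /= !addnS; congr [:: _, _ & iota _ _].
Qed.

(** The complement s collects the auxiliary letters left over by three-letter blocks. Comparison
    with a list known to have no repetition shows that the blocks use disjoint letters. *)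
Lemma used_subset M :
  exists s, perm_eq (letters M ++ iota N (size M).*2) (used M ++ s).
Proof.
have gen B M' ls : size ls = size M' -> exists s,
    perm_eq (letters M' ++ flatten [seq aux l | l <- ls])
      (flatten (unzip1 [seq block B el.1 el.2 | el <- zip M' ls]) ++ s).
  elim: M' ls => [|e M' IH] [|l ls] //=; first by move=> _; exists [::].
  move=> [/IH[s /permP Ps]].
  exists ((if mixed B e then [:: (N + l.*2.+1)%N] else [::]) ++ s).
  apply/permP => p; move: (Ps p); rewrite -/(letters M') /= !count_cat /=.
  move: (count p (letters M')) (count p (flatten [seq aux l | l <- ls])) => c1 c2.
  move: (count p (flatten (unzip1 [seq block B el.1 el.2 | el <- zip M' ls]))) => c3.
  by rewrite /block; case: mixed => /=; rewrite ?addn0 => E; lia.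
have [s Ps] := gen M M _ (size_iota 0 (size M)).
by exists s; rewrite flatten_aux addn0 in Ps.
Qed.

Lemma size_used M : (size (used M) + count (mixed M) M = 4 * size M)%N.
Proof.
have gen B M' ls : size ls = size M' ->
    (size (flatten (unzip1 [seq block B el.1 el.2 | el <- zip M' ls])) +
     count (mixed B) M' = 4 * size M')%N.
  elim: M' ls => [|e M' IH] [|l ls] //= [/IH {}IH].
  by rewrite size_cat {1}/block; case: mixed => /=; lia.
exact: gen (size_iota _ _).
Qed.

Lemma letters_used M : {subset letters M <= used M}.
Proof.
move=> i /mem_letters[e eM ie].
have lt : (index e M < size (zip M (iota 0 (size M))))%N.
  by rewrite size_zip size_iota minnn index_mem.
pose el := nth (e, 0%N) (zip M (iota 0 (size M))) (index e M).
have elE : el.1 = e by rewrite /el nth_zip ?size_iota //= nth_index.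
apply/flattenP; exists (block M el.1 el.2).1.
  by apply: map_f; apply: (map_f (fun el => block M el.1 el.2)); apply: mem_nth.
by rewrite elE /block; move: ie; rewrite !inE; case: mixed => /=; rewrite !inE => /orP[]->; rewrite ?orbT.
Qed.

Section Matching.
Variable M : seq (nat * nat).
Hypothesis matM : matching M.

Lemma uniq_letters_aux : uniq (letters M ++ iota N (size M).*2) /\
  {subset letters M ++ iota N (size M).*2 <= iota 0 n}.
Proof.
case: matM => sM uM /allP lM; split.
  rewrite cat_uniq uM iota_uniq andbT; apply/hasPn => i; rewrite mem_iota => /andP[Ni _].
  by apply/negP => /lM; rewrite ltnNge Ni.
move=> i; rewrite mem_cat !mem_iota => /orP[/lM|]; rewrite ?sM; lia.
Qed.

Lemma used_uniq : uniq (used M) /\ {subset used M <= iota 0 n}.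
Proof.
have [u sub] := uniq_letters_aux; have [s P] := used_subset M.
split; first by move: u; rewrite (perm_uniq P) cat_uniq => /andP[].
by move=> i iu; apply: sub; rewrite (perm_mem P) mem_cat iu.
Qed.

Lemma perm_used_rest : perm_eq (used M ++ rest M) (iota 0 n).
Proof.
have [u sub] := used_uniq; apply: uniq_perm; rewrite ?iota_uniq //.
  rewrite cat_uniq u filter_uniq ?iota_uniq // andbT.
  by apply/hasPn => i; rewrite mem_filter => /andP[].
move=> i; rewrite mem_cat mem_filter; have [/sub->//|_] := boolP (i \in used M).
by [].
Qed.

Lemma special_letter : (0 < m)%N -> special M \in letters M.
Proof.
case: matM => sM uM /allP lM m0; rewrite /special.
case E : [seq i <- iota 0 n | i \in letters M] => [|i s] /=; last first.
  by have := mem_head i s; rewrite -E mem_filter => /andP[].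
case: M sM lM E => [/esym m1|e M' _ lM E]; first by rewrite m1 in m0.
have eL : e.1 \in letters (e :: M') by rewrite letters_cons mem_head.
have : e.1 \in [seq i <- iota 0 n | i \in letters (e :: M')].
  by rewrite mem_filter eL mem_iota /=; have := lM _ eL; lia.
by rewrite E.
Qed.

Lemma count_mixed : (0 < m)%N -> count (mixed M) M = t.
Proof.
move=> m0; rewrite /mixed; case: t => /=; last exact: count_pred0.
move: (special_letter m0); move: (special M) => x; case: matM => _ uM _.
move: uM; elim: M => // e M' IH; rewrite letters_cons /= => /and3P[+ e2 uM].
rewrite !inE negb_or => /andP[e12 e1]; have [xM|xM] := boolP (x \in letters M').
  have n1 : x == e.1 = false by apply: contraNF e1 => /eqP <-.
  have n2 : x == e.2 = false by apply: contraNF e2 => /eqP <-.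
  by rewrite n1 n2 (IH uM xM).
rewrite orbF => ->; rewrite (_ : count _ _ = 0%N) //; apply/eqP; rewrite -leqn0 leqNgt -has_count.
by apply: contra xM => /hasP[e' eM' xe']; apply/mem_letters; exists e'.
Qed.

(** The blocks use 4m letters, or 4m - 1 when n is odd, since then exactly one pair is mixed. *)
Lemma even_rest : (0 < m)%N -> odd n = t -> ~~ odd (size (rest M)).
Proof.
move=> m0 nt; have := size_used M; rewrite count_mixed //.
have := perm_size perm_used_rest; rewrite size_cat size_iota.
move: (size (used M)) (size (rest M)) (size M) => a b c; rewrite -nt; clear; lia.
Qed.

Lemma flatten_blocks : (0 < m)%N -> odd n = t ->
  perm_eq (flatten (unzip1 (blocks M))) (iota 0 n).
Proof.
move=> m0 nt; rewrite /blocks /unzip1 map_cat flatten_cat flatten_pairup ?even_rest //.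
exact: perm_used_rest.
Qed.

Lemma homog_matching_poly : (0 < m)%N -> odd n = t -> homog X (iota 0 n) (matching_poly M).
Proof.
move=> m0 nt; refine (homog_perm (flatten_blocks m0 nt) _).
by apply: homog_prod; apply: homog_blocks.
Qed.

End Matching.

Section Pairing.
Hypothesis two_neq0 : (2 : K) != 0.
Hypotheses (m_gt0 : (0 < m)%N) (n_parity : odd n = t).

Definition pair_graph B := graph (pair_parity B) (pair_class B).

(** A letter outside B is odd and unlinked, so commutation with it reads off the parity of i. *)
Lemma pair_graph_aux B i a : a \notin letters B ->
  pair_graph B i a = pair_parity B i /\ pair_graph B a i = pair_parity B i.
Proof.
move=> aB; rewrite /pair_graph /graph /linked.
have -> : pair_parity B a = true by rewrite /pair_parity (negPf aB).
have -> : pair_class B a = 0%N by rewrite /pair_class (negPf aB).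
by rewrite andbT /=; case: eqP => /=; rewrite ?addbF.
Qed.

Lemma ell_block M B e l : matching B -> uniq (block M e l).1 ->
  all (fun i => i \notin letters B) (aux l) ->
  (ell (pair_graph B) X (block M e l).1 (block M e l).2 == 0) =
  ~~ (linked (pair_class B) e.1 e.2 &&
      if mixed M e then pair_parity B e.1
      else (pair_parity B e.1 && pair_parity B e.2) == (e.1 < e.2)%N).
Proof.
move=> matB; rewrite /aux /= andbT => + /andP[aB bB].
have [ga ga'] := (fun i => (pair_graph_aux i aB).1, fun i => (pair_graph_aux i aB).2).
have gb i := (pair_graph_aux i bB).1.
have gsym : symmetric (pair_graph B) by apply: graph_sym.
have gab : pair_graph B (N + l.*2) (N + l.*2.+1) = true.
  by rewrite gb /pair_parity (negPf aB).
have gij i j : pair_graph B i j = (pair_parity B i && pair_parity B j) (+) linked (pair_class B) i j by [].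
rewrite /block; case: mixed => /= u.
  rewrite (ell_blockP X two_neq0 gsym u (ga _) (ga' _)) gij.
  by case: pair_parity; case: pair_parity; case: linked.
have u' : uniq [:: e.1; e.2; (N + l.*2)%N; (N + l.*2.+1)%N].
  by rewrite -(perm_uniq (perm_swap12 _ _ _ _)).
case: (e.1 < e.2)%N.
  rewrite (ell_blockQ X two_neq0 gsym u' (ga _) (gb _) (ga _) (gb _)) gij.
  by case: pair_parity; case: pair_parity; case: linked.
rewrite (ell_blockR X two_neq0 gsym u' (ga _) (gb _) (ga _) (gb _) gab) gij.
by case: pair_parity; case: pair_parity; case: linked.
Qed.

End Pairing.
End Element.
End Family.

(** * Vanishing on the ideals and duality of the family *)

Section Kill.
Variables (par : nat -> bool) (kap : nat -> nat) (m : nat).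
Hypothesis kap_le : forall a, (kap a <= m)%N.
Variables (K : fieldType) (A : algType K) (X : word_basis A).

Lemma ell_graph_ideal0 W c p : uniq W ->
  (forall d, (0 < d)%N -> class kap d W <= 2)%N ->
  (forall w r, perm_eq (w ++ c ++ r) W ->
     ((full kap m w).*2.+1 < p)%N \/ (full kap m w + (odds par w)./2 < p)%N) ->
  forall f, comm_ideal p.+1 f -> ell (graph par kap) X W (X c * f) = 0.
Proof.
move=> uW cW fW; apply: (ell_ideal0 (@graph_sym par kap)) => // u s r sp P.
apply/negP => st; have c2 d : (0 < d)%N -> (class kap d (u ++ flatten s) <= 2)%N.
  move/cW; apply: leq_trans; rewrite /class -(permP P).
  by rewrite [leqRHS]count_cat leq_addr.
have [b1 b2] := steps_bound kap_le c2 st.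
by case: (fW _ _ P); rewrite -sp ltnNge ?b1 ?b2.
Qed.

End Kill.

Lemma uniq_flatten_mem (T : eqType) (ss : seq (seq T)) s :
  uniq (flatten ss) -> s \in ss -> uniq s.
Proof.
elim: ss => // s' ss IH /=; rewrite cat_uniq => /and3P[us _ uss].
by rewrite inE => /orP[/eqP->//|]; apply: IH.
Qed.

Section FamilyValues.
Variables (n m : nat).
Hypothesis n_large : (2 * m <= n)%N.
Hypothesis m_gt0 : (0 < m)%N.
Variables (K : fieldType) (A : algType K) (X : word_basis A).
Hypothesis two_neq0 : (2 : K) != 0.
Local Notation t := (odd n).
Local Notation N := (n - 2 * m)%N.
Local Notation matching := (matching n m).
Local Notation matching_poly := (matching_poly n m t X).
Local Notation pair_graph := (pair_graph n t).
Local Notation iota_n := (iota 0 n).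

Lemma aux_letters B l : matching B -> all (fun i => i \notin letters B) (aux n m l).
Proof.
move=> [_ _ /allP lB]; rewrite /aux /= andbT.
by apply/andP; split; apply/negP => /lB; rewrite ltnNge leq_addr.
Qed.

Lemma ell_matching_polyE M B : matching M -> matching B ->
  ell (pair_graph B) X iota_n (matching_poly M) != 0 ->
  forall e, e \in M -> linked (pair_class B) e.1 e.2 /\
    (if mixed n t M e then pair_parity n t B e.1
     else (pair_parity n t B e.1 && pair_parity n t B e.2) == (e.1 < e.2)%N).
Proof.
move=> matM matB; rewrite -(ell_perm _ _ _ (flatten_blocks n_large X matM m_gt0 erefl)).
rewrite /matching_poly ell_prod_eq0; last exact: homog_blocks.
rewrite -all_predC => /allP vM e eM.
have lt : (index e M < size (zip M (iota 0 (size M))))%N.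
  by rewrite size_zip size_iota minnn index_mem.
pose el := nth (e, 0%N) (zip M (iota 0 (size M))) (index e M).
have elE : el.1 = e by rewrite /el nth_zip ?size_iota //= nth_index.
have bM : block n m t X M e el.2 \in main_blocks n m t X M.
  by rewrite -{1}elE; apply: (map_f (fun el => block n m t X M el.1 el.2)); apply: mem_nth.
have /= := vM (block n m t X M e el.2); rewrite mem_cat bM => /(_ isT).
rewrite ell_block ?aux_letters // ?negbK; first by move/andP.
apply: uniq_flatten_mem (map_f fst bM).
by have [] := used_uniq t n_large X matM.
Qed.

(** Every pair of M must be linked for B, so by counting M and B have the same letters, hence the
    same special letter and the same mixed pair. A pair occurring in B in the opposite order would
    have the wrong parities for its block in M. *)
Lemma matching_poly_subset M B : matching M -> matching B ->
  ell (pair_graph B) X iota_n (matching_poly M) != 0 -> {subset M <= B}.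
Proof.
move=> matM matB nz; have vM := ell_matching_polyE matM matB nz.
have [sM uM _] := matM; have [sB uB _] := matB.
have ne e : e \in M -> e.1 != e.2 by apply: uniq_letters_neq.
have lMB : letters M =i letters B.
  have sub : {subset letters M <= letters B}.
    move=> i /mem_letters[e eM]; have [lk _] := vM _ eM.
    by have [e1 e2 _] := linked_mem lk (ne _ eM); rewrite !inE => /orP[]/eqP->.
  by have [] := uniq_min_size uM sub (_ : size (letters B) <= size (letters M))%N;
    rewrite !size_letters sM sB.
have spE : special n M = special n B by congr (head _ _); apply: eq_filter.
move=> [i j] eM; have [lk] := vM _ eM; have nij : i != j := ne _ eM.
have [iB jB /orP[//|jiB]] := linked_mem lk nij.
have parE x : x \in [:: i; j] -> pair_parity n t B x =
    if mixed n t M (i, j) then x == j else (j < i)%N.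
  move=> xij; rewrite /pair_parity.
  have xji : x \in [:: j; i] by move: xij; rewrite !inE orbC.
  have -> : x \in letters B by apply/mem_letters; exists (j, i).
  rewrite (nth_pair_index uB jiB xji) /= /mixed spE.
  by rewrite /= [_ \in [:: j; i]]inE /= !inE orbC.
rewrite !parE ?inE ?eqxx ?orbT //=; case: mixed; first by rewrite (negPf nij).
by move: nij; rewrite neq_ltn; case: ltngtP.
Qed.

(** Each block was chosen to detect its own pair, and the letters of [rest] are odd and unlinked, so
    they anticommute pairwise. *)
Lemma matching_poly_self M : matching M -> ell (pair_graph M) X iota_n (matching_poly M) != 0.
Proof.
move=> matM; have [sM uM lM] := matM.
rewrite -(ell_perm _ _ _ (flatten_blocks n_large X matM m_gt0 erefl)).
rewrite /matching_poly ell_prod_eq0; last exact: homog_blocks.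
have [uu _] := used_uniq t n_large X matM.
apply/hasPn => b; rewrite mem_cat => /orP[|].
  move=> bM; have /mapP[[e l] elM bE] := bM.
  have eM : e \in M.
    by have := map_f fst elM; rewrite -/unzip1 unzip1_zip ?size_iota.
  have ub : uniq b.1 by apply: uniq_flatten_mem (map_f fst bM).
  rewrite bE /= in ub *; rewrite ell_block ?aux_letters //= negbK linked_pair //=.
  have e1 : e.1 \in [:: e.1; e.2] by rewrite mem_head.
  have e2 : e.2 \in [:: e.1; e.2] by rewrite !inE eqxx orbT.
  have eL x : x \in [:: e.1; e.2] -> x \in letters M by move=> xe; apply/mem_letters; exists e.
  rewrite /pair_parity !eL // !(nth_pair_index uM eM) //.
  by case: mixed; rewrite ?eqxx ?andbb.
have ur : uniq (rest n m t X M) by rewrite filter_uniq ?iota_uniq.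
move=> /(mem_pairup ur)[y [z [yr zr yz ->]]] /=.
have rL x : x \in rest n m t X M -> x \notin letters M.
  by rewrite mem_filter => /andP[+ _]; apply: contra; apply: letters_used.
have gs : symmetric (pair_graph M) by apply: graph_sym.
rewrite (ell_comm_x X gs yz) mulf_eq0 signr_eq0 /=.
rewrite (pair_graph_aux n t y (rL _ zr)).1 /pair_parity (negPf (rL _ yr)).
by rewrite expr1 opprK.
Qed.

Lemma pair_graph_ideal0 B f : matching B -> comm_ideal (2 * m.+1).+1 f ->
  ell (pair_graph B) X iota_n f = 0.
Proof.
move=> [sB uB _] If; rewrite -[f]mul1r -(word_nil X).
apply: (@ell_graph_ideal0 (pair_parity n t B) (pair_class B) m _ _ _ X _ _ _ _ _ _ f If).
- by move=> a; rewrite -sB pair_class_le.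
- exact: iota_uniq.
- by move=> d d0; apply: class_le2; rewrite ?iota_uniq.
(* The m links allow 2m + 1 steps, while a commutator of length 2m + 3 has 2m + 2. *)
move=> w r _; left; have := full_le (pair_class B) m w; lia.
Qed.

Lemma matching_poly_independent (d : nat) (Ms : 'I_d -> seq (nat * nat)) (c : 'I_d -> K) :
  (forall i, matching (Ms i)) -> (forall i j, Ms i =i Ms j -> i = j) ->
  comm_ideal (2 * m.+1).+1 (\sum_i c i *: matching_poly (Ms i)) -> forall i, c i = 0.
Proof.
move=> matM injM /pair_graph_ideal0 Ic i; have := Ic _ (matM i).
rewrite ell_sum (bigD1 i) //= ellZ big1 ?addr0.
  by move=> /eqP; rewrite mulf_eq0 (negPf (matching_poly_self (matM i))) orbF => /eqP.
move=> j ji; rewrite ellZ; apply/eqP; rewrite mulf_eq0; apply/orP; right.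
apply: contraNT ji => /(matching_poly_subset (matM j) (matM i)) sub; apply/eqP/injM.
have [sj uj _] := matM j; have [si _ _] := matM i.
by have [] := uniq_min_size (uniq_letters uj) sub (_ : size (Ms i) <= size (Ms j))%N; rewrite ?si ?sj.
Qed.

End FamilyValues.

(** * Projection onto proper polynomials *)

Section LinearExtension.
Variables (K : fieldType) (A : algType K) (X : word_basis A) (phi : seq nat -> A).

Definition wsupp (f : A) : seq (seq nat) := undup (sval (cid (word_expand X f))).

Lemma mem_wsupp f w : coef X f w != 0 -> w \in wsupp f.
Proof.
rewrite mem_undup; case: cid => s /= fs; apply: contraR => ws.
rewrite fs wcoef_sum big_seq big1 // => v vs.
rewrite wcoefZ coef_word; case: eqP => [vw|_]; last by rewrite mulr0.
by rewrite -vw vs in ws.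
Qed.

Definition lext (f : A) : A := \sum_(w <- wsupp f) coef X f w *: phi w.

(** Words with coefficient 0 contribute nothing, so the sum can run over one list common to several
    polynomials; linearity follows. *)
Lemma lext_over f U : uniq U -> (forall w, coef X f w != 0 -> w \in U) ->
  lext f = \sum_(w <- U) coef X f w *: phi w.
Proof.
move=> uU fU; rewrite /lext.
have nz S : \sum_(w <- S) coef X f w *: phi w =
    \sum_(w <- [seq w <- S | coef X f w != 0]) coef X f w *: phi w.
  rewrite big_filter [RHS]big_mkcond; apply: eq_bigr => w _.
  by case: eqP => //= ->; rewrite scale0r.
rewrite nz [RHS]nz; apply: perm_big; apply: uniq_perm.
- by rewrite filter_uniq // undup_uniq.
- by rewrite filter_uniq.
by move=> w; rewrite !mem_filter; case: eqP => //= /eqP nzw; rewrite mem_wsupp // fU.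
Qed.

Lemma lext_lin a f g : lext (a *: f + g) = a *: lext f + lext g.
Proof.
pose U := undup (wsupp f ++ wsupp g); have uU : uniq U by apply: undup_uniq.
have fU w : coef X f w != 0 -> w \in U.
  by rewrite mem_undup mem_cat => /mem_wsupp->.
have gU w : coef X g w != 0 -> w \in U.
  by rewrite mem_undup mem_cat => /mem_wsupp->; rewrite orbT.
rewrite !(@lext_over _ U) // => [|w]; last first.
  rewrite coef_linear; have [->|/fU//] := eqVneq (coef X f w) 0.
  by rewrite mulr0 add0r => /gU.
rewrite scaler_sumr -big_split; apply: eq_bigr => w _ /=.
by rewrite coef_linear scalerDl scalerA.
Qed.

Lemma lext_word w : lext (X w) = phi w.
Proof.
rewrite (@lext_over _ [:: w]) // => [|v].
  by rewrite big_seq1 coef_word eqxx scale1r.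
by rewrite coef_word inE; have [//|_] := eqVneq w v; rewrite eqxx.
Qed.

Lemma lext0 : lext 0 = 0.
Proof. by have := lext_lin (-1) 0 0; rewrite !scaleN1r !addNr. Qed.

End LinearExtension.

Lemma perm_eq_rem (T : eqType) (x : T) (u v : seq T) :
  perm_eq u v -> perm_eq (rem x u) (rem x v).
Proof.
move=> uv; have [xu|xu] := boolP (x \in u); last first.
  by rewrite !rem_id // -(perm_mem uv).
rewrite -(perm_cons x); have xv : x \in v by rewrite -(perm_mem uv).
have := perm_to_rem xu; rewrite perm_sym => /perm_trans; apply.
exact: perm_trans uv (perm_to_rem xv).
Qed.

Section Derivation.
Variables (K : fieldType) (A : algType K) (X : word_basis A) (s : nat).
Local Notation x i := (X [:: i]).

(** Formal partial derivative of a word: the derivation sending x_s to 1 and the other letters to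
    0. *)
Fixpoint der_word (w : seq nat) : A :=
  if w is a :: w' then (if a == s then X w' else 0) + x a * der_word w' else 0.

Definition der : A -> A := lext X der_word.

Lemma der_lin a f g : der (a *: f + g) = a *: der f + der g.
Proof. exact: lext_lin. Qed.

Lemma der0 : der 0 = 0. Proof. exact: lext0. Qed.

Lemma derB f g : der (f - g) = der f - der g.
Proof. by rewrite addrC -scaleN1r der_lin scaleN1r addrC. Qed.

Lemma derM f g : der (f * g) = der f * g + f * der g.
Proof.
move: f; apply: (word_ind (X := X)) => [|a f1 f2 I1 I2|u].
- by rewrite !(mul0r, der0) addr0.
- by rewrite mulrDl -scalerAl !der_lin I1 I2 !mulrDl -!scalerAl scalerDr addrACA.
move: g; apply: (word_ind (X := X)) => [|a f1 f2 I1 I2|v].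
- by rewrite !(mulr0, der0) addr0.
- by rewrite mulrDr -scalerAr !der_lin I1 I2 !mulrDr -!scalerAr scalerDr addrACA.
rewrite wordM /der !lext_word; elim: u => [|a u IH] /=.
  by rewrite mul0r add0r word_nil mul1r.
rewrite IH mulrDl mulrDr !mulrA -addrA wordM; congr (_ + _).
by case: eqP => _; rewrite ?wordM ?mul0r.
Qed.

Lemma der1 : der 1 = 0.
Proof. by rewrite -(word_nil X) /der lext_word. Qed.

Lemma der_x i : der (x i) = (i == s)%:R.
Proof.
rewrite /der lext_word /= mulr0 addr0; case: eqP => _ //; exact: word_nil.
Qed.

Lemma der_comm f g : der (comm f g) = comm (der f) g + comm f (der g).
Proof. by rewrite /comm derB !derM opprD [- (der g * f) - _]addrC addrACA. Qed.

Lemma comm_nat (f : A) (b : bool) : comm f b%:R = 0.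
Proof. by case: b; rewrite /comm ?(mulr1, mul1r, mulr0, mul0r) subrr. Qed.

Lemma nat_comm (f : A) (b : bool) : comm b%:R f = 0.
Proof. by case: b; rewrite /comm ?(mulr1, mul1r, mulr0, mul0r) subrr. Qed.

(** The derivative of a letter is a scalar, hence central. *)
Lemma der_lcomm_vars c : (0 < size c.2)%N -> der (lcomm_vars X c) = 0.
Proof.
case: c => i l; rewrite /lcomm_vars /=; elim/last_ind: l => // l j IH _.
rewrite map_rcons lcomm_rcons der_comm der_x comm_nat addr0.
have [->|l0] := eqVneq l [::]; first by rewrite /= der_x nat_comm.
by rewrite IH ?comm0l // lt0n size_eq0.
Qed.

Lemma der_proper f : proper X f -> der f = 0.
Proof.
move: f; apply: (@lin_span_ind K A) => [|a f g If Ig|_ [cs cs0 ->]].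
- exact: der0.
- by rewrite der_lin If Ig scaler0 addr0.
elim: cs cs0 => [_|c cs IH /= /andP[c0 /IH{}IH]]; first by rewrite big_nil der1.
by rewrite big_cons derM IH der_lcomm_vars // mul0r mulr0 addr0.
Qed.

(** By the Leibniz rule each term differentiates a single entry, which leaves a commutator of the
    same length. *)
Lemma der_lcomm u l : lin_span (commutators (size l).+1) (der (lcomm u l)).
Proof.
have Ss p := @lin_span_submod K A (commutators p).
elim/last_ind: l => [|l v IH].
  by apply: lin_span_sub; exists (der u), [::].
rewrite lcomm_rcons der_comm size_rcons; apply: (submodD (Ss _)); last first.
  apply: lin_span_sub; exists u, (rcons l (der v)).
  by rewrite size_rcons lcomm_rcons.
move: (der _) IH; apply: (@lin_span_ind K A) => [|a f g If Ig|_ [u' [l' [sl ->]]]].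
- by rewrite comm0l; case: (Ss (size l).+2).
- by rewrite commDl commZl; apply: (proj2 (Ss _)).
apply: lin_span_sub; exists u', (rcons l' v).
by rewrite size_rcons lcomm_rcons -sl.
Qed.

Lemma comm_ideal_submod p : is_submod (@comm_ideal A p).
Proof.
have [I0 IB Il Ir] := ideal_gen_is_ideal (@commutators A p).
split=> // a f g If Ig; have -> : a *: f + g = a%:A * f - (- g).
  by rewrite opprK mulr_algl.
apply: (IB); first exact: Il.
by rewrite -sub0r; apply: IB.
Qed.

Lemma der_comm_ideal p f : comm_ideal p.+1 f -> comm_ideal p.+1 (der f).
Proof.
have [I0 IB Il Ir] := ideal_gen_is_ideal (@commutators A p.+1).
have Is := comm_ideal_submod p.+1.
move/(@comm_ideal_span _ _ X); move: f.
apply: (@lin_span_ind K A) => [|a f g If Ig|_ [a [b [u [l [sl ->]]]]]].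
- by rewrite der0.
- by rewrite der_lin; apply: (proj2 Is).
have IL := @comm_ideal_lcomm A (X u) (map X l); rewrite size_map sl in IL.
have IdL : comm_ideal p.+1 (der (lcomm (X u) (map X l))).
  have := @der_lcomm (X u) (map X l); rewrite size_map sl.
  move: (der (lcomm _ _)); apply: (@lin_span_ind K A) => [||h [u' [l' [[sl'] ->]]]].
  - by case: Is.
  - exact: (proj2 Is).
  by have := @comm_ideal_lcomm A u' l'; rewrite sl'.
rewrite !derM; apply: (submodD Is); first by apply: (Ir); apply: (submodD Is); apply: (Il).
by apply: (Ir); apply: (Il).
Qed.

Lemma der_word0 w : s \notin w -> der_word w = 0.
Proof.
elim: w => //= a w IH; rewrite inE negb_or eq_sym => /andP[/negPf-> /IH->].
by rewrite mulr0 addr0.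
Qed.

Lemma homog_der_word w : homog X (rem s w) (der_word w).
Proof.
elim: w => [|a w IH] /=; first exact: homog0.
have [->|ne] := eqVneq a s; last first.
  by rewrite add0r -[_ :: _]/([:: a] ++ _); apply: homogM; [exact: homog_x|exact: IH].
apply: homogD; first exact: homog_word.
have [sw|/der_word0->] := boolP (s \in w); last by rewrite mulr0; apply: homog0.
refine (homog_perm _ (homogM (@homog_x _ _ X s) IH)).
by rewrite perm_sym; apply: perm_to_rem.
Qed.

Lemma homog_der W f : homog X W f -> homog X (rem s W) (der f).
Proof.
move: f; apply: homog_ind => [|a f g If Ig|w wW].
- by rewrite der0; apply: homog0.
- by rewrite der_lin; apply: homog_lin.
rewrite /der lext_word; refine (homog_perm _ (@homog_der_word w)).
exact: perm_eq_rem.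
Qed.

(* Makes f proper in the variable s. *)
Definition rho (f : A) : A := f - x s * der f.

Lemma rho_lin a f g : rho (a *: f + g) = a *: rho f + rho g.
Proof.
by rewrite /rho der_lin mulrDr -scalerAr opprD scalerBr addrACA.
Qed.

Lemma homog_rho W f : s \in W -> homog X W f -> homog X W (rho f).
Proof.
move=> sW Wf; apply: homogB => //.
refine (homog_perm _ (homogM (@homog_x _ _ X s) (homog_der Wf))).
by rewrite perm_sym; apply: perm_to_rem.
Qed.

Lemma rho_comm_ideal p f : comm_ideal p.+1 f -> comm_ideal p.+1 (rho f).
Proof.
have [I0 IB Il Ir] := ideal_gen_is_ideal (@commutators A p.+1).
by move=> If; apply: IB => //; apply: Il; apply: der_comm_ideal.
Qed.

End Derivation.

Section ProperProjection.
Variables (K : fieldType) (A : algType K) (X : word_basis A).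
Local Notation x i := (X [:: i]).

Lemma comm_lcomm_vars c t : comm (lcomm_vars X c) (x t) = lcomm_vars X (c.1, rcons c.2 t).
Proof. by rewrite /lcomm_vars map_rcons lcomm_rcons. Qed.

Lemma commM (f g h : A) : comm (f * g) h = f * comm g h + comm f h * g.
Proof. by rewrite /comm mulrBr mulrBl !mulrA addrA addrNK. Qed.

Lemma proper_comm_x f t : proper X f -> proper X (comm f (x t)).
Proof.
have Ss := proper_submod X.
move: f; apply: (@lin_span_ind K A) => [|a f g If Ig|_ [cs cs0 ->]].
- by rewrite comm0l; case: Ss.
- by rewrite commDl commZl; apply: (proj2 Ss).
elim: cs cs0 => [_|c cs IH /= /andP[c0 cs0]].
  by rewrite big_nil /comm mul1r mulr1 subrr; case: Ss.
rewrite big_cons commM comm_lcomm_vars; apply: (submodD Ss).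
  by apply: properM; [exact: proper_lcomm|exact: IH].
apply: properM; first by apply: proper_lcomm; rewrite size_rcons.
by apply: lin_span_sub; exists cs.
Qed.

(** Interpolates between multilinear polynomials and proper ones: P says which letters may still
    stand outside commutators. *)
Definition word_proper (P : pred nat) : set A :=
  lin_span [set f | exists w c, [/\ uniq w, all P w, proper X c & f = X w * c]]%classic.

Lemma word_proper_submod P : is_submod (word_proper P).
Proof. exact: lin_span_submod. Qed.

Lemma word_proper_sub (P Q : pred nat) f : subpred P Q -> word_proper P f -> word_proper Q f.
Proof.
move=> PQ; have Ss := word_proper_submod Q; move: f.
apply: (@lin_span_ind K A) => [||f [w [c [uw wP Pc ->]]]]; [by case: Ss|exact: (proj2 Ss)|].
by apply: lin_span_sub; exists w, c; split=> //; apply: sub_all wP.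
Qed.

Lemma word_properMr P f h : proper X h -> word_proper P f -> word_proper P (f * h).
Proof.
move=> Ph; have Ss := word_proper_submod P; move: f.
apply: (@lin_span_ind K A) => [|a f g If Ig|f [w [c [uw wP Pc ->]]]].
- by rewrite mul0r; case: Ss.
- by rewrite mulrDl -scalerAl; apply: (proj2 Ss).
apply: lin_span_sub; exists w, (c * h); split=> //; last by rewrite mulrA.
exact: properM.
Qed.

Lemma word_proper_cons (P Q : pred nat) t f : subpred P Q -> Q t -> ~~ P t ->
  word_proper P f -> word_proper Q (x t * f).
Proof.
move=> PQ Qt Pt; have Ss := word_proper_submod Q; move: f.
apply: (@lin_span_ind K A) => [|a f g If Ig|f [w [c [uw wP Pc ->]]]].
- by rewrite mulr0; case: Ss.
- by rewrite mulrDr -scalerAr; apply: (proj2 Ss).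
apply: lin_span_sub; exists (t :: w), c; split=> //=.
- by rewrite uw andbT; apply: contra Pt => /(allP wP).
- by rewrite Qt (sub_all PQ wP).
by rewrite mulrA wordM.
Qed.

(** Moving a letter t to the left of c costs [c, x_t], which is proper again. *)
Lemma proper_word c w : proper X c -> uniq w -> word_proper (mem w) (c * X w).
Proof.
elim: w c => [|t w IH] c Pc /=.
  move=> _; rewrite word_nil mulr1; apply: lin_span_sub; exists [::], c.
  by rewrite word_nil mul1r.
move=> /andP[tw uw]; rewrite (word_cons X t w).
have -> : c * (x t * X w) = x t * (c * X w) + comm c (x t) * X w.
  by rewrite /comm mulrBl !mulrA addrC subrK.
have sub : subpred (mem w) (mem (t :: w)) by move=> i iw; apply/orP; right.
apply: (submodD (word_proper_submod _)).
  by apply: word_proper_cons (IH _ Pc uw) => //=; rewrite mem_head.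
apply: (word_proper_sub sub); apply: IH => //; exact: proper_comm_x.
Qed.

Lemma comm_word_proper u v s c : proper X c -> uniq (u ++ v) ->
  word_proper (mem (u ++ v)) (comm (X u) (x s) * (X v * c)).
Proof.
move=> Pc; elim: u => [_|t u IH /= /andP[tuv uuv]].
  rewrite word_nil /comm mul1r mulr1 subrr mul0r.
  by case: (word_proper_submod (mem ([::] ++ v))).
rewrite (word_cons X t u) commM mulrDl.
have sub : subpred (mem (u ++ v)) (mem (t :: u ++ v)).
  by move=> i iw; apply/orP; right.
apply: (submodD (word_proper_submod _)).
  by rewrite -mulrA; apply: word_proper_cons (IH uuv) => //=; rewrite mem_head.
rewrite mulrA -[_ * _ * X v]mulrA wordM; apply: word_properMr => //.
by apply: (word_proper_sub sub); apply: proper_word => //; apply: proper_comm.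
Qed.

Lemma der_wordE s u v : uniq (u ++ s :: v) -> der X s (X (u ++ s :: v)) = X (u ++ v).
Proof.
move=> us; rewrite /der lext_word; elim: u us => [|a u IH] /=.
  by move=> /andP[sv _]; rewrite eqxx der_word0 // mulr0 addr0.
move=> /andP[aus /IH->]; rewrite ifN ?add0r ?wordM //.
by apply: contraNneq aus => ->; rewrite mem_cat mem_head orbT.
Qed.

(** On a word u s v followed by a proper c, the operator gives [u, x_s] v c, where s stands only
    inside a commutator. *)
Lemma rho_word_proper P s f : word_proper P f -> word_proper [predD1 P & s] (rho X s f).
Proof.
have Ss := word_proper_submod [predD1 P & s]; move: f.
apply: (@lin_span_ind K A) => [|a f g If Ig|f [w [c [uw wP Pc ->]]]].
- by rewrite /rho der0 mulr0 subrr; case: Ss.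
- by rewrite rho_lin; apply: (proj2 Ss).
rewrite /rho derM (der_proper s Pc) mulr0 addr0.
have [sw|sw] := boolP (s \in w); last first.
  rewrite /der lext_word der_word0 // mul0r mulr0 subr0.
  apply: lin_span_sub; exists w, c; split=> //; apply/allP => i iw /=.
  by apply/andP; split; [apply: contraNneq sw => <-|exact: (allP wP)].
move: uw wP; case/splitPr: sw => u v uw wP.
rewrite der_wordE //.
have -> : X (u ++ s :: v) * c - x s * (X (u ++ v) * c) = comm (X u) (x s) * (X v * c).
  rewrite /comm mulrBl -[s :: v]/([:: s] ++ v) -!wordM.
  by rewrite !mulrA.
have uv : uniq (u ++ v) by move: uw; rewrite !cat_uniq /= negb_or => /and3P[-> /andP[_ ->] /andP[_ ->]].
refine (word_proper_sub _ (comm_word_proper s Pc uv)) => i /= iuv.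
apply/andP; split; last first.
  by apply: (allP wP); move: iuv; rewrite !mem_cat inE => /orP[]->; rewrite ?orbT.
apply: contraTneq iuv => ->; move: uw; rewrite cat_uniq /= negb_or.
case/and3P=> _ /andP[su _] /andP[sv _].
change (s \notin u ++ v); rewrite mem_cat.
by apply/norP.
Qed.

Definition rhos (S : seq nat) (f : A) : A := foldr (rho X) f S.

Lemma rhos_word_proper S P f : word_proper P f ->
  word_proper [pred i | P i & i \notin S] (rhos S f).
Proof.
move=> Pf; elim: S => [|s S IH] /=.
  by apply: word_proper_sub Pf => i /= ->.
refine (word_proper_sub _ (@rho_word_proper _ s _ IH)) => i /= /andP[ns /andP[Pi iS]].
by rewrite Pi; apply/norP.
Qed.

(** After one operator for each letter of W no letter is allowed outside commutators, so only the
    empty word remains in front. *)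
Lemma rhos_proper W f : uniq W -> homog X W f -> proper X (rhos W f).
Proof.
move=> uW Wf; have : word_proper (mem W) f.
  have Ss := word_proper_submod (mem W).
  move: f Wf; apply: homog_ind => [||w wW]; [by case: Ss|exact: (proj2 Ss)|].
  apply: lin_span_sub; exists w, 1; split; rewrite ?mulr1 ?(perm_uniq wW) //.
    by apply/allP => i; rewrite (perm_mem wW).
  exact: proper1.
move=> /(@rhos_word_proper W); move: (rhos W f); have Ss := proper_submod X.
apply: (@lin_span_ind K A) => [||h [w [c [_ /allP wP Pc ->]]]]; [by case: Ss|exact: (proj2 Ss)|].
case: w wP => [|i w] wP; first by rewrite word_nil mul1r.
by have /= := wP i (mem_head _ _) => /andP[->].
Qed.

Lemma homog_rhos W S f : {subset S <= W} -> homog X W f -> homog X W (rhos S f).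
Proof.
move=> + Wf; elim: S => //= s S IH sub; apply: homog_rho.
  by apply: sub; rewrite mem_head.
by apply: IH => i iS; apply: sub; rewrite inE iS orbT.
Qed.

Lemma rhos_comm_ideal p S f : comm_ideal p.+1 f -> comm_ideal p.+1 (rhos S f).
Proof. by move=> If; elim: S => //= s S IH; apply: rho_comm_ideal. Qed.

Lemma ell_rhos g W p S f :
  (forall s h, s \in S -> comm_ideal p.+1 h -> ell g X W (x s * h) = 0) ->
  comm_ideal p.+1 f -> ell g X W (rhos S f) = ell g X W f.
Proof.
move=> + If; elim: S => //= s S IH vS; rewrite /rho ellB.
rewrite (vS s) ?mem_head // ?subr0 ?IH // => [i h iS|]; first by apply: vS; rewrite inE iS orbT.
by apply: der_comm_ideal; apply: rhos_comm_ideal.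
Qed.

End ProperProjection.

(** * An element separating consecutive ideals *)

Section Strict.
Variables (k q : nat).
Hypotheses (k_gt0 : (0 < k)%N) (q_gt0 : (0 < q)%N) (q_le : (q <= 2 * k)%N).

Definition strict_parity (a : nat) : bool := (a < 2 * k)%N.

(* The odd letters are those below 2k.  Entry i of the commutator is i, together with
   2k + i when 0 < i < q, and entry 2k is the letter 2k; the linked letters are
   the last letters of the entries 2j - 1 and 2j, for 1 <= j <= k. *)
Definition strict_class (a : nat) : nat :=
  if (a < 2 * k)%N then (if (q <= a)%N then uphalf a else 0%N)
  else if a == (2 * k)%N then k
  else if (a < 2 * k + q)%N then uphalf (a - 2 * k)%N else 0%N.

Definition strict_entry (i : nat) : seq nat :=
  if i == (2 * k)%N then [:: (2 * k)%N]
  else if (0 < i < q)%N then [:: i; (2 * k + i)%N] else [:: i].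

Local Notation entries i p := [seq strict_entry j | j <- iota i p].
Local Notation n := (2 * k + q)%N.

Lemma strict_class_le a : (strict_class a <= k)%N.
Proof. rewrite /strict_class; case: ifP => h1; case: ifP => h2 //; last case: ifP => h3 //; lia. Qed.

Lemma class_entry c i : (0 < c)%N -> (i <= 2 * k)%N ->
  class strict_class c (strict_entry i) = ((0 < i) && (c == uphalf i))%N.
Proof.
move=> c0 ik; rewrite /class /strict_entry /strict_class.
have [->|ne] := eqVneq i (2 * k)%N.
  by rewrite /= ltnn eqxx; lia.
have ik' : (i < 2 * k)%N by lia.
case: ifP => [/andP[i0 iq]|iq] /=.
  rewrite ik' leqNgt iq /= (_ : (2 * k + i < 2 * k)%N = false); last by lia.
  by rewrite (_ : (2 * k + i == 2 * k)%N = false) ?ltn_add2l ?iq ?addKn; lia.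
by rewrite ik'; case: (leqP q i) => qi; lia.
Qed.

Lemma odds_entry i : (i <= 2 * k)%N ->
  odds strict_parity (strict_entry i) = (i != 2 * k)%N.
Proof.
move=> ik; rewrite /odds /strict_entry /strict_parity; case: eqP => /= [_|ne].
  by rewrite ltnn.
by case: ifP => _ /=; lia.
Qed.

Lemma class_entries c j : (0 < c)%N -> (j <= 2 * k)%N ->
  class strict_class c (flatten (entries 0 j.+1)) = ((c.*2.-1 <= j) + (c.*2 <= j))%N.
Proof.
move=> c0; elim: j => [_|j IH jk]; first by rewrite /= cats0 class_entry //; lia.
rewrite -addn1 iotaD map_cat flatten_cat class_cat IH ?(ltnW jk) //= cats0 add0n.
by rewrite class_entry //; lia.
Qed.

Lemma odds_entries j : (j <= 2 * k)%N ->
  odds strict_parity (flatten (entries 0 j)) = j.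
Proof.
elim: j => // j IH jk; rewrite -addn1 iotaD map_cat flatten_cat /odds count_cat.
by rewrite -!/(odds _ _) IH ?(ltnW jk) //= cats0 add0n odds_entry ?(ltnW jk) //; lia.
Qed.

(** The two kinds of steps alternate: entry 2j - 1 brackets two words with an odd number of odd
    letters, and entry 2j uses up link j after a prefix with an even number of them. *)
Lemma strict_steps j : (j <= 2 * k)%N ->
  steps (graph strict_parity strict_class) (strict_entry 0) (entries 1 j).
Proof.
elim: j => // j IH jk; have -> : iota 1 j.+1 = rcons (iota 1 j) j.+1.
  by rewrite -{1}[j.+1]addn1 iotaD cats1 add1n.
rewrite map_rcons steps_rcons IH ?(ltnW jk) //=.
rewrite (odd_crossing _ strict_class_le).
rewrite -[strict_entry 0 ++ _]/(flatten (entries 0 j.+1)).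
rewrite odds_entries // odds_entry //.
rewrite (eq_big_nat _ _ (F2 := fun c => ((c.*2.-1 <= j) + (c.*2 <= j)) * (c == uphalf j.+1))%N); last first.
  by move=> c /andP[c0 _]; rewrite class_entries ?class_entry // ltnW.
rewrite (bigD1_seq (uphalf j.+1)) ?iota_uniq ?mem_index_iota //=; last by lia.
rewrite eqxx muln1 big1 ?addn0; last by move=> c /negPf->; rewrite muln0.
by rewrite /=; lia.
Qed.

Lemma perm_entries : perm_eq (strict_entry 0 ++ flatten (entries 1 (2 * k))) (iota 0 n).
Proof.
(* The entries before entry j contain, besides the odd letters below j, the even letters 2k + i with
   0 < i < min(j, q). *)
have gen j : (0 < j <= 2 * k)%N ->
    perm_eq (flatten (entries 0 j)) (iota 0 j ++ iota (2 * k).+1 (minn j q).-1).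
  elim: j => // j IH /andP[_ jk].
  have [->|j0] := posnP j.
    by rewrite /= /strict_entry /= (_ : 0 == 2 * k = false)%N ?(minn_idPl q_gt0) //; lia.
  rewrite -addn1 iotaD map_cat flatten_cat /= cats0 add0n.
  have /permP P := IH (introT andP (conj j0 (ltnW jk))).
  apply/permP => p; rewrite count_cat P !count_cat /strict_entry.
  rewrite (_ : j == 2 * k = false)%N; last by lia.
  rewrite j0 /=; have [jq|jq] := boolP (j < q)%N => /=.
    have -> : (minn (j + 1) q).-1 = ((minn j q).-1 + 1)%N by lia.
    rewrite iotaD count_cat /= (_ : (2 * k).+1 + (minn j q).-1 = 2 * k + j)%N; last by lia.
    by rewrite !addn0; lia.
  have -> : (minn (j + 1) q).-1 = (minn j q).-1 by lia.
  by rewrite !addn0; lia.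
rewrite -[_ ++ _]/(flatten (entries 0 (2 * k).+1)) -addn1 iotaD map_cat flatten_cat.
have /gen/permP P : (0 < 2 * k <= 2 * k)%N by lia.
apply/permP => p; rewrite count_cat P /= cats0 add0n /strict_entry eqxx (minn_idPr q_le).
rewrite -[in RHS](prednK q_gt0) iotaD count_cat add0n /= !count_cat /=.
by rewrite !addn0; lia.
Qed.

Lemma class_iota c : (0 < c)%N -> (class strict_class c (iota 0 n) <= 2)%N.
Proof.
move=> c0; rewrite /class -(permP perm_entries) -/(class _ _ _).
rewrite -[_ ++ _]/(flatten (entries 0 (2 * k).+1)) class_entries //.
lia.
Qed.

Lemma odds_iota : odds strict_parity (iota 0 n) = (2 * k)%N.
Proof.
rewrite /odds iotaD count_cat add0n.
have /eqP -> : count strict_parity (iota 0 (2 * k)) == (2 * k)%N.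
  rewrite -[X in _ == X](size_iota 0 (2 * k)) -all_count.
  by apply/allP => a; rewrite mem_iota.
rewrite (_ : count _ _ = 0%N) ?addn0 //; apply/eqP; rewrite -leqn0 leqNgt -has_count.
by apply/hasPn => a; rewrite mem_iota /strict_parity -leqNgt => /andP[].
Qed.

Variables (K : fieldType) (A : algType K) (X : word_basis A).
Hypothesis two_neq0 : (2 : K) != 0.

Local Notation g := (graph strict_parity strict_class).

Lemma strict_witness : exists f : A,
  [/\ homog X (iota 0 n) f, proper X f, comm_ideal (2 * k).+1 f &
      ~ comm_ideal (2 * k).+2 f].
Proof.
pose f0 := lcomm (X (strict_entry 0)) (map X (entries 1 (2 * k))).
have gs : symmetric g by apply: graph_sym.
have Hf0 : homog X (iota 0 n) f0.
  exact: homog_perm perm_entries (@homog_lcomm _ _ X _ _).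
have If0 : comm_ideal (2 * k).+1 f0.
  have := @comm_ideal_lcomm A (X (strict_entry 0)) (map X (entries 1 (2 * k))).
  by rewrite !size_map size_iota.
have un : uniq (iota 0 n) by apply: iota_uniq.
have ell_f0 : ell g X (iota 0 n) f0 != 0.
  rewrite -(ell_perm _ _ _ perm_entries) ell_lcomm ?(perm_uniq perm_entries) //.
  by rewrite strict_steps // mulf_neq0 ?signr_eq0 ?expf_neq0.
(* With s set aside, either at most 2k - 1 odd letters are left, or s is even, hence linked, and its
   link cannot become full. Both cases leave fewer than 2k steps. *)
have kill s h : s \in iota 0 n -> comm_ideal (2 * k).+1 h -> ell g X (iota 0 n) (X [:: s] * h) = 0.
  move=> sn; apply: (ell_graph_ideal0 strict_class_le) => // [d|w r P]; first exact: class_iota.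
  right; have Fw := full_le strict_class k w.
  have Ow : (odds strict_parity w + strict_parity s <= 2 * k)%N.
    rewrite -odds_iota /odds -(permP P) !count_cat /=; lia.
  have [s2|s2] := boolP (strict_parity s); first by rewrite s2 in Ow; lia.
  suff : (full strict_class k w < k)%N by lia.
  have c0 : (0 < strict_class s)%N.
    move: sn s2; rewrite mem_iota /strict_class /strict_parity => /andP[_ sn] s2.
    by rewrite (negPf s2); case: eqP => // ne; rewrite sn; move: s2 ne; clear; lia.
  apply: (@full_lt _ _ _ (strict_class s)); first by rewrite c0 strict_class_le.
  have := class_iota c0; rewrite /class -(permP P) !count_cat /= eqxx; lia.
exists (rhos X (iota 0 n) f0); split.
- exact: homog_rhos.
- exact: rhos_proper.
- exact: rhos_comm_ideal.
move=> I2; case/negP: ell_f0; rewrite -(ell_rhos kill If0); apply/eqP.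
rewrite -[rhos _ _ _]mul1r -(word_nil X).
move: I2; apply: (ell_graph_ideal0 strict_class_le) => // [d|w r P]; first exact: class_iota.
(* Here at most k + k steps are possible, fewer than the 2k + 1 of a commutator of length 2k + 2. *)
right; have Fw := full_le strict_class k w.
have Ow : (odds strict_parity w <= 2 * k)%N.
  by rewrite -odds_iota /odds -(permP P) !count_cat /=; lia.
lia.
Qed.

End Strict.

(** * Proper codimensions *)

Section LowDegree.
Variables (K : fieldType) (A : algType K) (X : word_basis A).

(** A commutator with an empty entry is a commutator with 1 and vanishes; otherwise every entry
    contributes at least one letter. *)
Lemma lcomm_words_size u s : (0 < size s)%N ->
  lcomm (X u) (map X s) = 0 \/ (size s < size (u ++ flatten s))%N.
Proof.
elim/last_ind: s => // s v IH _; rewrite map_rcons lcomm_rcons flatten_rcons catA.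
have [->|v0] := eqVneq v [::].
  by left; rewrite word_nil /comm mulr1 mul1r subrr.
have [->|s0] := eqVneq s [::].
  have [->|u0] := eqVneq u [::].
    by left; rewrite /= word_nil /comm mulr1 mul1r subrr.
  right; rewrite /= !size_cat /=; move: u0 v0; rewrite -!size_eq0; clear.
  by move: (size u) (size v); lia.
case: IH => [|->|lt]; [by rewrite lt0n size_eq0|by left; rewrite comm0l|right].
rewrite size_rcons (size_cat (u ++ _)); move: v0 lt; rewrite -size_eq0; clear.
by move: (size v) (size s) (size (u ++ _)); lia.
Qed.

Lemma comm_ideal_low p f w : (0 < p)%N -> comm_ideal p.+1 f -> (size w <= p)%N ->
  coef X f w = 0.
Proof.
move=> p0 /(@comm_ideal_span _ _ X) If wp; move: f If.
apply: (@lin_span_ind K A) => [|a f g f0 g0|f [a [b [u [s [sp ->]]]]]].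
- exact: wcoef0.
- by rewrite coef_linear f0 g0 mulr0 addr0.
have [|->|lt] := @lcomm_words_size u s; rewrite ?sp //.
  by rewrite mulr0 mul0r wcoef0.
apply/eqP; apply: contraT => nz.
have H : homog X ((a ++ (u ++ flatten s)) ++ b) (X a * lcomm (X u) (map X s) * X b).
  apply: homogM; last exact: homog_word.
  by apply: homogM; [exact: homog_word|exact: homog_lcomm].
have := perm_size (H _ nz); rewrite size_cat (size_cat a).
by move: lt wp; rewrite sp; clear; move: (size (u ++ _)) (size w) (size a) (size b); lia.
Qed.

End LowDegree.

(** * Transfer to the concrete free algebra and its relatively free quotients *)

Section FreeAlgebraWords.
Variable K : fieldType.
Local Notation F := (freealg K).

Fact freealg_scaleAr (a : K) (f g : F) : a *: (f * g) = f * (a *: g).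
Proof.
apply/malgP => m; transitivity (a * (f * g)@_m); first exact: mcoeffZ.
rewrite (mcoeffMl f g m) mulr_sumr.
rewrite (mcoeffMlw (d1 := msupp f) (d2 := msupp g)) ?msuppZ_le //.
apply: eq_bigr => m1 _; rewrite mulr_sumr; apply: eq_bigr => m2 _.
by rewrite mcoeffZ mulrnAr mulrCA.
Qed.

HB.instance Definition _ := GRing.Lalgebra_isAlgebra.Build K (freealg K) freealg_scaleAr.

Definition freealg_word (w : seq nat) : F := << FMonom w >>.
Definition freealg_coef (f : F) (w : seq nat) : K := f@_(FMonom w).

Fact freealg_word_nil : freealg_word [::] = 1.
Proof. by congr (<< _ >>); rewrite -fmoneE. Qed.

Fact freealg_wordM u v : freealg_word u * freealg_word v = freealg_word (u ++ v).
Proof.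
rewrite /freealg_word malgM_def fgmulUU mul1r; congr (<< _ >>).
by apply: val_inj; rewrite /= fmM.
Qed.

Fact freealg_coef_word u v : freealg_coef (freealg_word u) v = (u == v)%:R.
Proof. by rewrite /freealg_coef mcoeffU1 fmP. Qed.

Fact freealg_coef_linear a (f g : F) w :
  freealg_coef (a *: f + g) w = a * freealg_coef f w + freealg_coef g w.
Proof. by rewrite /freealg_coef mcoeffD mcoeffZ. Qed.

Fact freealg_word_expand (f : F) :
  exists s, f = \sum_(w <- s) freealg_coef f w *: freealg_word w.
Proof.
exists [seq fmonom_val m | m <- msupp f]; rewrite big_map {1}[f]monalgE.
apply: eq_bigr => m _; apply/malgP => m'.
by rewrite mcoeffZ /freealg_coef /freealg_word !mcoeffU fmK mulr_natr.
Qed.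

Definition freealg_words : word_basis F :=
  WordBasis freealg_word_nil freealg_wordM freealg_coef_word freealg_coef_linear
    freealg_word_expand.

End FreeAlgebraWords.

Section Bridge.
Variable K : fieldType.
Local Notation F := (freealg K).
Local Notation X := (freealg_words K).

Lemma xvar_word i : xvar K i = X [:: i].
Proof. by rewrite /xvar /= /freealg_word fmuE. Qed.

Lemma proper_polyE (f : F) : proper X f -> proper_poly f.
Proof.
have Ss : is_submod (@proper_poly K) by apply: lin_span_submod.
move: f; apply: (@lin_span_ind K F) => [||f [cs cs0 ->]].
- by case: Ss.
- by case: Ss.
apply: lin_span_sub; exists cs => //; apply: eq_bigr => c _.
rewrite /lcomm_vars xvar_word; congr (lcomm _ _).
by apply: eq_map => i; rewrite xvar_word.
Qed.

Lemma multilinearE n (f : F) : homog X (iota 0 n) f -> multilinear n f.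
Proof. by move=> Hf m fm; apply: Hf; rewrite /= /freealg_coef fmK. Qed.

Lemma multilinear_freealgn n (f : F) : multilinear n f -> f \in in_freealgn n.
Proof.
move=> Mf; rewrite [f]monalgE; apply: rpred_sum => m _.
have [->|fm] := eqVneq f@_m 0; first by rewrite monalgU0 rpred0.
have -> : << f@_m *g m >> = f@_m *: (<< m >> : F).
  by apply/malgP => m'; rewrite mcoeffZ !mcoeffU mulr_natr.
apply: rpredZ; rewrite -[m]fmK; apply: xmonom_in_freealgn.
by apply/allP => i; rewrite (perm_mem (Mf _ fm)) mem_iota.
Qed.

(** [gammaN] is the largest d admitting such a family, so codimensions can be compared without
    handling the quotient. *)
Definition gamma_family p n d (f : 'I_d -> F) : Prop :=
  [/\ forall i, multilinear n (f i), forall i, proper_poly (f i) &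
      forall c : 'I_d -> K, comm_ideal p.+1 (\sum_i c i *: f i) -> forall i, c i = 0].

Lemma gamma_family_le p n d (f : 'I_d -> F) : gamma_family p n f -> (d <= gammaN K p n)%N.
Proof.
move=> [Mf Pf If].
pose f' i : freealgn K n := FreeAlgn (multilinear_freealgn (Mf i)).
have [d' [b bB]] := GammaN_has_basis K p n.
rewrite /gammaN (dimE bB); case: bB => _ _ sb.
apply: (@lin_indep_le _ _ d' d b (fun i => relfree_pi K p n (f' i))); last first.
  by move=> i; apply: sb; exists (f' i) => //; split; [exact: Mf|exact: Pf].
move=> c c0; apply: If.
have : relfree_pi K p n (\sum_i c i *: f' i) = relfree_pi K p n 0.
  rewrite linear_sum raddf0 -[RHS]c0; apply: eq_bigr => i _; exact: linearZ.
move/relfree_eqE; rewrite raddf0 addr0 raddf_sum.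
suff -> : \sum_i \val (c i *: f' i) = \sum_i c i *: f i by [].
by apply: eq_bigr => i _; exact: linearZ.
Qed.

Lemma gamma_family_max p n :
  exists f : 'I_(gammaN K p n) -> F, gamma_family p n f.
Proof.
have [d [b bB]] := GammaN_has_basis K p n.
rewrite /gammaN (dimE bB); case: bB => gb ib _.
have {}gb i : exists f : freealgn K n, Gamma K n f /\ relfree_pi K p n f = b i.
  by have [f Gf fb] := gb i; exists f.
have [f fP] := choice gb.
exists (fun i => \val (f i)); split.
- by move=> i; have [[]] := fP i.
- by move=> i; have [[]] := fP i.
move=> c Ic; apply: ib.
transitivity (relfree_pi K p n (\sum_i c i *: f i)).
  rewrite linear_sum; apply: eq_bigr => i _.
  by rewrite -(fP i).2; apply/esym; exact: linearZ.
transitivity (relfree_pi K p n 0); last exact: raddf0.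
apply/relfree_eqE; rewrite raddf0 addr0 raddf_sum.
suff -> : \sum_i \val (c i *: f i) = \sum_i c i *: \val (f i) by [].
by apply: eq_bigr => i _; exact: linearZ.
Qed.

End Bridge.

(** * Counting matchings *)

Section Count.
Variables (n m : nat).
Local Notation N := (n - 2 * m)%N.

Definition pairs_of (M : {set 'I_N * 'I_N}) : seq (nat * nat) :=
  [seq (val e.1, val e.2) | e <- enum M].

Definition matchings : {set {set 'I_N * 'I_N}} :=
  [set M : {set 'I_N * 'I_N} | (#|M| == m) && uniq (letters (pairs_of M))].

Lemma size_pairs_of M : size (pairs_of M) = #|M|.
Proof. by rewrite size_map -cardE. Qed.

Lemma matching_pairs_of M : M \in matchings -> matching n m (pairs_of M).
Proof.
rewrite inE => /andP[/eqP cM uM]; split=> //; first by rewrite size_pairs_of.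
apply/allP => i /mem_letters[_ /mapP[e _ ->]]; rewrite !inE /=.
by move=> /orP[]/eqP->.
Qed.

Lemma pairs_of_inj M M' : pairs_of M =i pairs_of M' -> M = M'.
Proof.
have inj : injective (fun e : 'I_N * 'I_N => (val e.1, val e.2)).
  by move=> [a b] [c d] /= [/val_inj-> /val_inj->].
by move=> MM'; apply/setP => e; have := MM' (val e.1, val e.2); rewrite !(mem_map inj) !mem_enum.
Qed.

(** An injection of ['I_m * bool] into the letters lists the pairs of a matching in some order, and
    a matching of m pairs has at most m! such listings. *)
Lemma card_matchings : (N ^_ (2 * m) <= #|matchings| * m`!)%N.
Proof.
pose H := [set h : {ffun 'I_m * bool -> 'I_N} | injectiveb h].
have <- : #|H| = (N ^_ (2 * m))%N.
  by rewrite card_inj_ffuns card_prod !card_ord card_bool mulnC.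
pose gr (h : {ffun 'I_m * bool -> 'I_N}) : {ffun 'I_m -> 'I_N * 'I_N} :=
  [ffun l => (h (l, true), h (l, false))].
have gr_inj : injective gr.
  move=> h h' /ffunP hh'; apply/ffunP => -[l b]; have := hh' l; rewrite !ffunE.
  by case: b => -[].
pose im h := [set gr h l | l in 'I_m].
have imJ h : h \in H -> im h \in matchings.
  rewrite inE => /injectiveP ih; rewrite inE.
  have ig : injective (gr h).
    by move=> l l'; rewrite !ffunE => -[/ih[]].
  have cM : #|im h| = m by rewrite card_imset ?card_ord.
  rewrite cM eqxx /=.
  apply: (@leq_size_uniq _ [seq val (h x) | x <- enum {: 'I_m * bool}]).
  - by rewrite map_inj_uniq ?enum_uniq // => x y /val_inj/ih.
  - move=> _ /mapP[[l b] _ ->]; apply/mem_letters.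
    exists (val (gr h l).1, val (gr h l).2).
      by apply: map_f; rewrite mem_enum; apply: imset_f.
    by rewrite !ffunE /= !inE; case: b; rewrite eqxx ?orbT.
  rewrite size_letters size_pairs_of cM size_map -cardE card_prod card_ord card_bool.
  by rewrite muln2.
rewrite -sum1_card (partition_big im (mem matchings)) //=.
rewrite -sum_nat_const; apply: leq_sum => M /[dup] MJ; rewrite inE => /andP[/eqP cM _].
rewrite sum1_card; have <- : #|M| ^_ #|'I_m| = m`! by rewrite card_ord cM ffactnn.
rewrite -card_inj_ffuns_on -(card_imset _ gr_inj).
apply: subset_leq_card; apply/fintype.subsetP => g /imsetP[h].
rewrite unfold_in /= inE => /andP[/injectiveP ih /eqP hM] ->; rewrite inE; apply/andP; split.
  by apply/ffun_onP => l; rewrite -hM imset_f.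
by apply/injectiveP => l l'; rewrite !ffunE => -[/ih[]].
Qed.

End Count.

Section Comparison.
Variables (K : fieldType) (p n : nat).

Lemma gammaN_mono : (gammaN K p n <= gammaN K p.+1 n)%N.
Proof.
have [f [Mf Pf If]] := gamma_family_max K p n.
by apply: (@gamma_family_le _ _ _ _ f); split=> // c /comm_idealS; apply: If.
Qed.

(** Adjoining h to a maximal family keeps it independent: modulo I_(p+1) the element h disappears
    and the old coefficients vanish, after which h alone would lie in I_(p+2). *)
Lemma gammaN_lt (h : freealg K) : multilinear n h -> proper_poly h ->
  comm_ideal p.+1 h -> ~ comm_ideal p.+2 h -> (gammaN K p n < gammaN K p.+1 n)%N.
Proof.
move=> Mh Ph Ih nIh; have [f [Mf Pf If]] := gamma_family_max K p n.
pose f' (i : 'I_(gammaN K p n).+1) := oapp f h (unlift ord0 i).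
apply: (@gamma_family_le _ _ _ _ f'); split=> [i|i|c]; rewrite /f'.
- by case: unlift.
- by case: unlift.
rewrite big_ord_recl unlift_none /=.
under eq_bigr do rewrite liftK /=.
move=> Ic; have Is := @comm_ideal_submod _ (freealg K).
have cl : forall i, c (lift ord0 i) = 0.
  apply: If; have := submodB (Is p.+1) (comm_idealS Ic) (submodZ (Is p.+1) (c ord0) Ih).
  by rewrite addrAC subrr add0r.
have c0 : c ord0 = 0.
  apply/eqP; apply: contraT => nz; case: nIh.
  have := submodZ (Is p.+2) (c ord0)^-1 Ic; rewrite [X in _ + X]big1 ?addr0.
    by rewrite scalerA mulVf // scale1r.
  by move=> i _; rewrite cl scale0r.
by move=> i; case: (unliftP ord0 i) => [j|] ->.
Qed.

Lemma relfree_pi_bij : (0 < p)%N -> (n <= p)%N ->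
  set_bij (Gamma K n) (GammaN K p n) (relfree_pi K p n).
Proof.
move=> p0 np; split=> [f Gf|f g|_ [f Gf <-]]; [by exists f| |by exists f].
move=> /set_mem[Mf _] /set_mem[Mg _] /relfree_eqE Ifg; apply: val_inj.
apply: (@eq_coef _ _ (freealg_words K)) => w.
have [/eqP fw|fw] := boolP (coef (freealg_words K) (\val f) w == 0).
  have [/eqP->//|gw] := boolP (coef (freealg_words K) (\val g) w == 0).
  have wn := perm_size (Mg _ gw); rewrite size_iota /= in wn.
  apply/eqP; rewrite -subr_eq0 -wcoefB; apply/eqP.
  by apply: comm_ideal_low p0 Ifg _; rewrite wn.
have wn := perm_size (Mf _ fw); rewrite size_iota /= in wn.
apply/eqP; rewrite -subr_eq0 -wcoefB; apply/eqP.
by apply: comm_ideal_low p0 Ifg _; rewrite wn.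
Qed.

End Comparison.

(** * Numerical estimates for the lower bound *)

Lemma central_bin_le k : (4 <= k)%N -> ('C(k.*2, k) <= 2 ^ (2 * k - 3) * k.+1)%N.
Proof.
elim: k => // k IH; rewrite ltnS leq_eqVlt => /orP[/eqP <-//|k4].
(* The recurrence (k+1) C(2k+2, k+1) = 2 (2k+1) C(2k, k), with an extra factor k+1 that lets the two
   binomial identities combine without division. *)
have e : (k.+1 * (k.+1 * 'C(k.+1.*2, k.+1)) = k.+1 * (2 * (k.*2.+1 * 'C(k.*2, k))))%N.
  have h1 := mul_bin_diag k.*2.+2 k; have h2 := mul_bin_down k.*2.+1 k.
  rewrite /= in h1 h2; rewrite doubleS -h1.
  have E : (k.*2.+1 - k = k.+1)%N by lia.
  by rewrite E in h2; rewrite h2; lia.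
move/eqP: e; rewrite eqn_pmul2l // => /eqP e.
rewrite -(leq_pmul2l (m := k.+1)) // e.
have -> : (2 * k.+1 - 3 = (2 * k - 3) + 2)%N by lia.
rewrite expnD; have := IH k4; move: (2 ^ _)%N ('C(_, _)) => x y; clear; nia.
Qed.

Lemma fact_double_ge m : (3 <= m)%N -> (2 ^ (2 * m) * m`! <= (2 * m)`!)%N.
Proof.
elim: m => // m IH; rewrite ltnS leq_eqVlt => /orP[/eqP <-//|m3].
have := IH m3; have -> : (2 * m.+1 = (2 * m).+2)%N by lia.
rewrite !factS !expnS; move: (2 ^ _)%N (m`!) ((2 * m)`!) => x y z; move: m3; clear; nia.
Qed.

Definition lead_coeff (k : nat) : rat :=
  (2 ^+ (2 * k - 3) + catalan (if k == 3%N then k.-1 else k)) / ((2 * k - 2)`!)%:R.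

Lemma catalan_gt0 k : 0 < catalan k.
Proof. by rewrite /catalan divr_gt0 ?ltr0n // bin_gt0 -addnn leq_addr. Qed.

Lemma lead_coeff_gt0 k : 0 < lead_coeff k.
Proof.
rewrite /lead_coeff divr_gt0 ?ltr0n ?fact_gt0 //.
by rewrite addr_gt0 ?catalan_gt0 ?exprn_gt0.
Qed.

Lemma lead_coeff_le m : (2 <= m)%N -> lead_coeff m.+1 * (m`!)%:R <= 1.
Proof.
move=> m2; rewrite /lead_coeff.
have -> : (2 * m.+1 - 2 = 2 * m)%N by lia.
rewrite mulrAC ler_pdivrMr ?ltr0n ?fact_gt0 // mul1r.
(* The estimate 4^m m! <= (2m)! fails at m = 2, where the value is computed directly as 20/24. *)
have [->|m3] := eqVneq m 2; first by rewrite /catalan /=; vm_compute.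
have {m2 m3} m3 : (3 <= m)%N by move: m2 m3; clear; lia.
rewrite ifN; last by apply/eqP; move: m3; clear; lia.
apply: (@le_trans _ _ ((2 ^ (2 * m) * m`!)%N%:R)); last by rewrite ler_nat fact_double_ge.
rewrite natrM ler_wpM2r ?ler0n //.
(* One half matches the power of 2 in the leading coefficient; the other bounds the Catalan
   number. *)
have -> : (2 ^ (2 * m) = 2 ^ (2 * m.+1 - 3) + 2 ^ (2 * m.+1 - 3))%N.
  by rewrite addnn -mul2n -expnS; congr (2 ^ _)%N; move: m3; clear; lia.
rewrite natrD natrX lerD2l /catalan.
rewrite ler_pdivrMr ?ltr0n // -natrX -natrM ler_nat.
by apply: central_bin_le.
Qed.

(** Homogeneous Bernoulli inequality. In the induction, multiplying by x - d leaves a surplus of x^r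
    (r+1) d^2. *)
Lemma bernoulli_sub (x d : rat) r : 0 <= d -> d <= x ->
  x ^+ r * (x - r.+1%:R * d) <= (x - d) ^+ r.+1.
Proof.
move=> d0 dx; elim: r => [|r IH]; first by rewrite expr0 mul1r mul1r expr1.
have x0 : 0 <= x by apply: le_trans dx.
rewrite [leRHS]exprS; apply: (@le_trans _ _ ((x - d) * (x ^+ r * (x - r.+1%:R * d)))).
  rewrite -subr_ge0 [X in 0 <= X](_ : _ = x ^+ r * (r.+1%:R * d ^+ 2)); last first.
    by rewrite exprS -(natr1 r.+1); ring.
  by rewrite mulr_ge0 ?exprn_ge0 ?mulr_ge0 ?ler0n ?sqr_ge0.
by rewrite ler_wpM2l // subr_ge0.
Qed.

Lemma ffact_ge N r : ((N - r) ^ r <= N ^_ r)%N.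
Proof.
rewrite ffact_prod -[X in (_ ^ X)%N](card_ord r) -prod_nat_const.
by apply: leq_prod => i _; apply: leq_sub2l; apply: ltnW.
Qed.

(* The root makes the polynomial nonpositive for small n, and Bernoulli's inequality
   takes care of the other n. *)
Definition lower_poly (k : nat) : {poly rat} :=
  lead_coeff k *: ('X^(2 * k - 3) * ('X - ((8 * (k.-1 * k.-1))%N%:R)%:P)).

Lemma lead_lower_poly k : lead_coef (lower_poly k) = lead_coeff k.
Proof. by rewrite lead_coefZ lead_coefM lead_coefXn lead_coefXsubC !mulr1. Qed.

Lemma size_lower_poly k : (3 <= k)%N -> size (lower_poly k) = (2 * k - 2).+1.
Proof.
move=> k3; rewrite size_scale ?gt_eqF ?lead_coeff_gt0 //.
rewrite size_monicM ?monicXn -?size_poly_eq0 ?size_XsubC // size_polyXn.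
by move: k3; clear; lia.
Qed.

Lemma lower_poly_le m n (D : nat) : (2 <= m)%N ->
  ((2 * m <= n)%N -> ((n - 2 * m) ^_ (2 * m) <= D * m`!)%N) ->
  (lower_poly m.+1).[n%:R] <= D%:R.
Proof.
move=> m2 HD; rewrite /lower_poly hornerZ hornerM hornerXn hornerXsubC /=.
have L0 := lead_coeff_gt0 m.+1.
have [nc|cn] := ltnP n (8 * (m * m)).
  apply: (@le_trans _ _ 0); last exact: ler0n.
  rewrite pmulr_rle0 // mulr_ge0_le0 ?exprn_ge0 ?ler0n //.
  by rewrite subr_le0 ler_nat ltnW.
have n4 : (4 * m <= n)%N by move: cn m2; clear; nia.
have {}HD : ((n - 4 * m) ^ (2 * m) <= D * m`!)%N.
  have := HD _; have -> : (2 * m <= n)%N by move: n4; clear; lia.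
  move=> /(_ isT); apply: leq_trans; apply: leq_trans (ffact_ge _ _).
  by rewrite leq_exp2r; [move: n4; clear; lia|move: m2; clear; lia].
(* Bernoulli with exponent 2m and d = 4m; the product 2m * 4m is the root 8 m^2 of [lower_poly]. *)
have B : n%:R ^+ (2 * m.+1 - 3) * (n%:R - (8 * (m * m))%N%:R) <=
    ((n - 4 * m) ^ (2 * m))%N%:R :> rat.
  have e : ((2 * m.+1 - 3).+1 = 2 * m)%N by move: m2; clear; lia.
  have := @bernoulli_sub n%:R (4 * m)%N%:R (2 * m.+1 - 3); rewrite e ler0n ler_nat n4.
  move=> /(_ isT isT); rewrite -(natrM _ (2 * m)) -(natrB _ n4) -[leRHS]natrX.
  by have -> : (2 * m * (4 * m) = 8 * (m * m))%N by clear; nia.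
apply: (@le_trans _ _ (lead_coeff m.+1 * (D * m`!)%N%:R)).
  by rewrite ler_pM2l //; apply: le_trans B _; rewrite ler_nat.
rewrite natrM mulrCA -[leRHS]mulr1 ler_wpM2l ?ler0n //.
exact: lead_coeff_le.
Qed.

Lemma gammaN_ge_matchings (K : fieldType) (n m : nat) : (2 : K) != 0 -> (0 < m)%N ->
  (2 * m <= n)%N -> (#|matchings n m| <= gammaN K (2 * m.+1) n)%N.
Proof.
move=> two0 m0 mn; pose X := freealg_words K.
pose Ms (i : 'I_#|matchings n m|) := pairs_of (enum_val i).
have matM i : matching n m (Ms i) by apply: matching_pairs_of; apply: enum_valP.
apply: (@gamma_family_le K _ n _ (fun i => matching_poly n m (odd n) X (Ms i))).
split=> [i|i|c Ic].
- by apply: multilinearE; apply: homog_matching_poly.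
- by apply: proper_polyE; apply: proper_matching_poly.
apply: (matching_poly_independent mn m0 two0 matM _ Ic) => i j /pairs_of_inj.
exact: enum_val_inj.
Qed.

Theorem corollary3p11 (K : fieldType) (charK : [pchar K] =i pred0)
    (k : nat) (k_ge3 : (3 <= k)%N) :
  [/\ exists pk : {poly rat},
        [/\ size pk = (2 * k - 2).+1,
            lead_coef pk =
              (2 ^+ (2 * k - 3) + catalan (if k == 3%N then k.-1 else k))
                / ((2 * k - 2)`!)%:R &
            forall n : nat, (2 * k <= n)%N ->
              (gammaN K (2 * k) n <= gammaN K (2 * k + 1) n)%N /\
              pk.[n%:R] <= (gammaN K (2 * k) n)%:R],
      forall n : nat, (n <= 2 * k)%N ->
        set_bij (Gamma K n) (GammaN K (2 * k + 1) n)
                (relfree_pi K (2 * k + 1) n) /\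
        set_bij (Gamma K n) (GammaN K (2 * k) n) (relfree_pi K (2 * k) n) &
      forall n : nat, (2 * k + 1 <= n <= 4 * k)%N ->
        (gammaN K (2 * k) n < gammaN K (2 * k + 1) n)%N].
Proof.
have two0 : (2 : K) != 0 by rewrite (pcharf0P K).1.
split.
- exists (lower_poly k); split; first exact: size_lower_poly.
    exact: lead_lower_poly.
  move=> n kn; split; first by rewrite addn1; apply: gammaN_mono.
  case: k k_ge3 kn => // m m2 kn; apply: lower_poly_le => // mn.
  apply: leq_trans (card_matchings n m) _; rewrite leq_mul2r; apply/orP; right.
  by apply: gammaN_ge_matchings => //; apply: ltnW.
- by move=> n nk; split; apply: relfree_pi_bij; move: nk k_ge3; clear; lia.
move=> n /andP[n1 n2]; rewrite addn1.
(* The construction has q = n - 2k even letters, and 0 < q <= 2k is exactly the stated range of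
   n. *)
have [||| f [Hf Pf If nIf]] := @strict_witness k (n - 2 * k) _ _ _ K _ (freealg_words K) two0.
- by move: k_ge3; clear; lia.
- by move: n1; clear; lia.
- by move: n2; clear; lia.
apply: (@gammaN_lt K (2 * k) n f) => //; last exact: proper_polyE.
by apply: multilinearE; move: Hf; rewrite subnKC // ltnW // -addn1.
Qed.
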